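(* Let $K$ be an algebraically closed field and $n\ge 1$. Then \[ \sum_{A} q^{\operatorname{gldim}(A)} = \sum_{D} q^{\operatorname{height}(D)}, \] where the first sum ranges over all connected linear Nakayama algebras over $K$ with $n$ simple modules (up to isomorphism) and the second sum ranges over all Dyck paths of semilength $n-1$. That is, the global dimension of connected linear Nakayama algebras with $n$ simple modules is equidistributed with the height of Dyck paths of semilength $n-1$.
   Context: A connected linear Nakayama algebra with $n$ simple modules is a $K$-algebra isomorphic to $T_n(K)/I$, where $T_n(K)$ is the algebra of upper triangular $n\times n$ matrices and $I\subseteq J^2$ is an ideal, $J$ being the ideal of strictly upper triangular matrices; equivalently a bound quiver algebra $KQ/I$ with $Q$ the linear quiver $0\to 1\to\cdots\to n-1$ and $I$ admissible. Up to isomorphism such an algebra is determined by its Kupisch series $[c_0,\dots,c_{n-1}]$, $c_i=\dim_K e_iA$, and the Kupisch series occurring are exactly the integer sequences with $c_{i+1}+1\ge c_i\ge 2$ for $0\le i<n-1$ and $c_{n-1}=1$. The global dimension $\operatorname{gldim}(A)$ is the supremum of the projective dimensions of all finitely generated $A$-modules. A Dyck path of semilength $m$ is a lattice path from $(0,0)$ to $(2m,0)$ with steps $(1,1)$ and $(1,-1)$ never going below the $x$-axis; its height is the maximal $y$-coordinate it attains. *)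

(* Defs.v *)
From HB Require Import structures.
From mathcomp Require Import all_boot all_order all_algebra.
Set Implicit Arguments. Unset Strict Implicit. Unset Printing Implicit Defensive.
Import GRing.Theory.
Local Open Scope ring_scope.

(* Finite-dimensional representations of the linear quiver 0 -> 1 -> 2 -> ...*)
(* A representation V consists of K-vector spaces K^(rdim V i) at the         *)
(* vertices i and linear maps V_i -> V_(i+1), acting on row vectors           *)
(* (v |-> v *m rmap V i).                                                     *)
Record rep (K : fieldType) := Rep {
  rdim : nat -> nat ;
  rmap : forall i : nat, 'M[K]_(rdim i, rdim i.+1)
}.

Fixpoint pmx (K : fieldType) (V : rep K) (i k : nat)
  : 'M[K]_(rdim V i, rdim V (i + k)) :=
  match k return 'M[K]_(rdim V i, rdim V (i + k)) with
  | 0 => castmx (erefl, congr1 (rdim V) (esym (addn0 i))) 1%:M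
  | k'.+1 => castmx (erefl, congr1 (rdim V) (esym (addnS i k')))
                    (pmx V i k' *m rmap V (i + k'))
  end.

(* V is a (finite-dimensional, right) module over the connected linear       *)
(* Nakayama algebra with n simples and Kupisch series c, i.e. a              *)
(* representation of the linear quiver 0 -> ... -> n-1 bound by the          *)
(* relations "the path of length c_i starting at i is zero".                 *)
Definition is_rep (K : fieldType) (n : nat) (c : nat -> nat) (V : rep K) : Prop :=
  (forall i, (n <= i)%N -> rdim V i = 0%N) /\
  (forall i, (i < n)%N -> pmx V i (c i) = 0).

Definition hom (K : fieldType) (V W : rep K) :=
  forall i : nat, 'M[K]_(rdim V i, rdim W i).

Definition is_hom (K : fieldType) (V W : rep K) (phi : hom V W) : Prop :=
  forall i, rmap V i *m phi i.+1 = phi i *m rmap W i.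

Definition surj (K : fieldType) (V W : rep K) (phi : hom V W) : Prop :=
  forall i, \rank (phi i) = rdim W i.

Definition inj (K : fieldType) (V W : rep K) (phi : hom V W) : Prop :=
  forall i, \rank (phi i) = rdim V i.

Definition exact_at (K : fieldType) (V W X : rep K) (phi : hom V W) (psi : hom W X)
  : Prop :=
  forall i, phi i *m psi i = 0 /\ (\rank (phi i) + \rank (psi i))%N = rdim W i.

Definition projective (K : fieldType) (n : nat) (c : nat -> nat) (P : rep K) : Prop :=
  is_rep n c P /\
  forall (M N : rep K) (g : hom M N) (h : hom P N),
    is_rep n c M -> is_rep n c N -> is_hom g -> surj g -> is_hom h ->
    exists h' : hom P M, is_hom h' /\ forall i, h' i *m g i = h i.

(* a projective resolution 0 -> C_(k+1) -> ... -> C_1 -> C_0 = M -> 0,      *)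
(* i.e. 0 -> P_k -> ... -> P_0 -> M -> 0 with P_j = C_(j+1)                  *)
Definition proj_resolution (K : fieldType) (n : nat) (c : nat -> nat) (M : rep K)
  (k : nat) : Prop :=
  exists (C : nat -> rep K) (d : forall j : nat, hom (C j.+1) (C j)),
    C 0%N = M /\
    (forall j, (j <= k)%N -> is_hom (d j)) /\
    (forall j, (1 <= j <= k.+1)%N -> projective n c (C j)) /\
    surj (d 0%N) /\
    (forall j, (j < k)%N -> exact_at (d j.+1) (d j)) /\
    inj (d k).

Definition pd_le (K : fieldType) (n : nat) (c : nat -> nat) (M : rep K) (m : nat)
  : Prop :=
  exists k, (k <= m)%N /\ proj_resolution n c M k.

Definition gldim_le (K : fieldType) (n : nat) (c : nat -> nat) (m : nat) : Prop :=
  forall M : rep K, is_rep n c M -> pd_le n c M m.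

Definition is_gldim (K : fieldType) (n : nat) (c : nat -> nat) (g : nat) : Prop :=
  gldim_le K n c g /\ forall m, gldim_le K n c m -> (g <= m)%N.

(* Kupisch series [c_0,...,c_(n-1)]; entries lie in [1,n], so they are       *)
(* encoded as n-tuples over 'I_n.+1.                                          *)
Definition kval (n : nat) (c : n.-tuple 'I_n.+1) : nat -> nat :=
  fun i => nth 0%N (map val c) i.

Definition kupisch (n : nat) (c : n.-tuple 'I_n.+1) : bool :=
  [forall i : 'I_n, ((i.+1 < n)%N ==> (2 <= kval c i <= (kval c i.+1).+1)%N)]
  && (kval c n.-1 == 1%N).

(* Dyck paths: true = up step (1,1), false = down step (1,-1).               *)
Definition ups (s : seq bool) : nat := count id s.
Definition downs (s : seq bool) : nat := count negb s.

Definition dyck (m : nat) (s : (2 * m).-tuple bool) : bool :=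
  [forall k : 'I_(2 * m).+1, (downs (take k s) <= ups (take k s))%N]
  && (ups s == downs s).

Definition height (m : nat) (s : (2 * m).-tuple bool) : nat :=
  \max_(k < (2 * m).+1) (ups (take k s) - downs (take k s))%N.

(* Main.v *)
(* Write f(i) = i + c_i.  Indecomposables are the intervals [a, b) with
   b <= f(a); the projective cover of [a, b) is [a, f(a)) and its syzygy is
   [b, f(a)).  Since projective dimension at most k is stable under extensions,
   gldim <= k is decided on the simples [i, i+1) by iterating
   (a, b) |-> (b, f(a)).

   Encode f by a Dyck word U r D in which the (j+1)-th down step is preceded by
   f(j) up steps.  Second syzygies of simples are the [v, v') with v, v'
   consecutive values of f, so passing to the sorted list of values lowers a
   global dimension that is at least two by two, and yields a possibly
   disconnected algebra, i.e. an arbitrary Dyck word s.  Reading the positions 1, ..., n-1, where position i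
   carries an up step if f(i-1) < f(i), then a down step if i is a value of f,
   spells s, and f is recovered from s and the gaps between these letters.
   Dually, deleting all peaks of a nonempty Dyck word lowers its height by one
   and removing the ground level from each prime factor lowers it by one more.
   A peak of s of positive height may have both steps at the same position,
   whereas after deletion of peaks every remaining peak had one inserted; after
   shifting the gaps accordingly both reconstructions depend on the same data,
   namely 2 |s| + 1 arbitrary natural numbers (|s| the semilength), because the
   two kinds of peaks are complementary in number along the recursion.  This
   gives recursively a permutation of Dyck words carrying gldim to height. *)

Require Import Defs.
From HB Require Import structures.
From mathcomp Require Import all_boot all_order all_algebra.
From mathcomp Require Import zify.
Set Implicit Arguments. Unset Strict Implicit. Unset Printing Implicit Defensive.
Import GRing.Theory.

(** * Projective dimension of representations *)

Section Homological.
Import Defs.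
Local Open Scope ring_scope.

Variable K : fieldType.
Implicit Types (U V W X : rep K).

(** The rank conditions are restated for elements: the [m] rows of [A] are [m] elements at one
    vertex, so that diagram chases become matrix equations. *)
Lemma injP V W (phi : hom V W) :
  inj phi <-> forall i m (A : 'M_(m, _)), A *m phi i = 0 -> A = 0.
Proof.
split=> [Hi i m A HA | H i].
  have Hf : row_free (phi i) by rewrite /row_free Hi.
  by apply: (row_free_inj Hf); rewrite mul0mx.
apply/eqP; change (row_free (phi i)); rewrite -kermx_eq0.
by apply/eqP; apply: H; apply: mulmx_ker.
Qed.

Lemma surjP V W (phi : hom V W) :
  surj phi <-> forall i, exists S, S *m phi i = 1%:M.
Proof.
split=> [Hs i | H i].
  by apply/row_fullP; rewrite /row_full Hs.
by apply/eqP; apply/(@row_fullP _ _ _ (phi i)).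
Qed.

Lemma exactP V W X (phi : hom V W) (psi : hom W X) :
  exact_at phi psi <-> (forall i, phi i *m psi i = 0) /\
    (forall i m (A : 'M_(m, _)), A *m psi i = 0 -> exists B, A = B *m phi i).
Proof.
split=> [He | [H0 H] i]; last split=> //.
  split=> [i | i m A HA]; first by case: (He i).
  have [H0 Hr] := He i.
  have Hsub : (phi i <= kermx (psi i))%MS by apply/sub_kermxP.
  have Heq : (kermx (psi i) <= phi i)%MS.
    by rewrite -(geq_leqif (mxrank_leqif_sup Hsub)) mxrank_ker leq_subLR addnC Hr.
  apply/submxP; apply: submx_trans Heq; exact/sub_kermxP.
have Hsub : (phi i <= kermx (psi i))%MS by apply/sub_kermxP.
have [B HB] := H i _ _ (mulmx_ker (psi i)).
have Heq : (kermx (psi i) <= phi i)%MS by rewrite HB submxMl.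
have -> : \rank (phi i) = \rank (kermx (psi i)).
  by apply/eqP; rewrite eqn_leq !mxrankS.
by rewrite mxrank_ker subnK // rank_leq_row.
Qed.

Lemma inj_cancel V W (phi : hom V W) i m (A B : 'M_(m, _)) :
  inj phi -> A *m phi i = B *m phi i -> A = B.
Proof.
move=> /injP Hi HAB; apply/eqP; rewrite -subr_eq0; apply/eqP.
by apply: Hi; rewrite mulmxBl HAB subrr.
Qed.

Definition ses V W X (phi : hom V W) (psi : hom W X) :=
  [/\ is_hom phi, is_hom psi, inj phi, exact_at phi psi & surj psi].

Definition hom_comp V W X (phi : hom V W) (psi : hom W X) : hom V X :=
  fun i => phi i *m psi i.

Lemma hom_comp_hom V W X (phi : hom V W) (psi : hom W X) :
  is_hom phi -> is_hom psi -> is_hom (hom_comp phi psi).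
Proof. by move=> H1 H2 i; rewrite /hom_comp mulmxA H1 -mulmxA H2 mulmxA. Qed.

Lemma id_hom V : is_hom ((fun i => 1%:M) : hom V V).
Proof. by move=> i; rewrite mulmx1 mul1mx. Qed.

Lemma add_hom V W (phi psi : hom V W) :
  is_hom phi -> is_hom psi -> is_hom ((fun i => phi i + psi i) : hom V W).
Proof. by move=> H1 H2 i; rewrite mulmxDr mulmxDl H1 H2. Qed.

Lemma sub_hom V W (phi psi : hom V W) :
  is_hom phi -> is_hom psi -> is_hom ((fun i => phi i - psi i) : hom V W).
Proof. by move=> H1 H2 i; rewrite mulmxBr mulmxBl H1 H2. Qed.

(** A lift of [psi] along [iota], meaningful only when the image of [psi] lies in that of [iota];
    the pseudo-inverse makes it total. *)
Definition factor U V W (iota : hom V W) (psi : hom U W) : hom U V :=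
  fun i => psi i *m pinvmx (iota i).

Lemma factK U V W X (iota : hom V W) (p : hom W X) (psi : hom U W) :
  exact_at iota p -> (forall i, psi i *m p i = 0) ->
  forall i, factor iota psi i *m iota i = psi i.
Proof.
move=> /exactP [_ He] H i; rewrite /factor; have [B ->] := He _ _ _ (H i).
by rewrite mulmxKpV ?submxMl.
Qed.

Lemma factor_hom U V W X (iota : hom V W) (p : hom W X) (psi : hom U W) :
  is_hom iota -> inj iota -> exact_at iota p -> is_hom psi ->
  (forall i, psi i *m p i = 0) -> is_hom (factor iota psi).
Proof.
move=> Hh Hi He Hpsi H i; have := factK He H; move: (factor iota psi) => t HK.
by apply: (inj_cancel Hi); rewrite -!mulmxA HK Hh mulmxA HK Hpsi.
Qed.

Section Kernel.
Variables (V W : rep K) (phi : hom V W).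

Definition kerinc i := row_base (kermx (phi i)).

(** The structure maps rewrite the image of a kernel basis in the basis chosen at the next
    vertex. *)
Definition kernel : rep K :=
  Rep (fun i => kerinc i *m rmap V i *m pinvmx (kerinc i.+1)).

Definition kernel_inc : hom kernel V := kerinc.

Lemma kernel_inc_exact : exact_at kernel_inc phi.
Proof.
apply/exactP; split=> [i | i m A HA].
  by apply/sub_kermxP; rewrite /kernel_inc /kerinc eq_row_base.
by apply/submxP; rewrite /kernel_inc /kerinc eq_row_base; apply/sub_kermxP.
Qed.

Lemma kernel_inc_inj : inj kernel_inc.
Proof. by move=> i; rewrite /kernel_inc /kerinc eq_row_base. Qed.

Hypothesis Hphi : is_hom phi.

Lemma kernel_inc_hom : is_hom kernel_inc.
Proof.
move=> i /=; rewrite /kernel_inc mulmxKpV //.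
rewrite /kerinc eq_row_base; apply/sub_kermxP.
have /exactP [H0 _] := kernel_inc_exact.
by rewrite -mulmxA Hphi mulmxA; have := H0 i; 
  rewrite /kernel_inc /kerinc => ->; rewrite mul0mx.
Qed.

Lemma kernel_ses : surj phi -> ses kernel_inc phi.
Proof.
move=> Hs; split=> //.
- exact: kernel_inc_hom.
- exact: kernel_inc_inj.
- exact: kernel_inc_exact.
Qed.

End Kernel.

(** Path maps carry transports along [i + 0 = i] and [i + k.+1 = (i + k).+1]; this lemma and the
    next two move them through products. *)
Lemma castmx_fam V (m : nat) (q : forall j, 'M[K]_(m, rdim V j)) i j (e : i = j) :
  castmx (erefl, congr1 (rdim V) e) (q i) = q j.
Proof. by case: j / e; rewrite castmx_id. Qed.

Lemma castmx_hom V W (phi : hom V W) m i j (e : i = j) (A : 'M[K]_(m, rdim V i)) :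
  castmx (erefl, congr1 (rdim V) e) A *m phi j =
  castmx (erefl, congr1 (rdim W) e) (A *m phi i).
Proof. by case: j / e; rewrite !castmx_id. Qed.

Lemma castmx_mull m p i j (d : nat -> nat) (e : i = j)
    (A : 'M[K]_(m, d i)) (B : 'M[K]_(p, m)) :
  castmx (erefl, congr1 d e) (B *m A) =
  B *m castmx (erefl, congr1 d e) A.
Proof. by case: j / e; rewrite !castmx_id. Qed.

Lemma pmx_hom V W (phi : hom V W) i k :
  is_hom phi -> pmx V i k *m phi (i + k)%N = phi i *m pmx W i k.
Proof.
move=> H; elim: k => [|k IHk] /=.
  by rewrite castmx_hom -castmx_mull mul1mx mulmx1.
by rewrite castmx_hom -castmx_mull -mulmxA H !mulmxA IHk.
Qed.

Lemma pmx_fam V m (q : forall j, 'M[K]_(m, rdim V j)) i k :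
  (forall j, (j < k)%N -> q (i + j).+1 = q (i + j)%N *m rmap V (i + j)) ->
  q (i + k)%N = q i *m pmx V i k.
Proof.
elim: k => [|k IHk] H /=; rewrite -castmx_mull.
  by rewrite mulmx1 castmx_fam.
rewrite mulmxA -IHk => [|j Hj]; last by apply: H; lia.
by rewrite -H // castmx_fam.
Qed.

Variables (n : nat) (c : nat -> nat).

Notation isr := (@is_rep K n c).
Notation proj := (@projective K n c).

Lemma sub_isr V W (phi : hom V W) : is_hom phi -> inj phi -> isr W -> isr V.
Proof.
move=> Hh Hi [H0 Hp]; split=> i Hn.
  have := Hi i; move: (phi i); rewrite (H0 i Hn) => A.
  by rewrite thinmx0 mxrank0.
by apply: (inj_cancel Hi); rewrite pmx_hom // Hp // mulmx0 mul0mx.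
Qed.

Lemma quot_isr V W (phi : hom V W) : is_hom phi -> surj phi -> isr V -> isr W.
Proof.
move=> Hh Hs [H0 Hp]; split=> i Hn.
  have := Hs i; move: (phi i); rewrite (H0 i Hn) => A.
  by rewrite flatmx0 mxrank0.
have /surjP /(_ i) [S HS] := Hs.
by rewrite -[LHS]mul1mx -HS -mulmxA -pmx_hom // Hp // mul0mx mulmx0.
Qed.

Lemma kernel_isr V W (phi : hom V W) : is_hom phi -> isr V -> isr (kernel phi).
Proof. by move=> Hh; apply: sub_isr (kernel_inc_hom Hh) (kernel_inc_inj phi). Qed.

(** * Direct sums *)

Definition dsum V W : rep K :=
  Rep (fun i => block_mx (rmap V i) 0 0 (rmap W i)).

Definition dinl V W : hom V (dsum V W) := fun i => row_mx 1%:M 0.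
Definition dinr V W : hom W (dsum V W) := fun i => row_mx 0 1%:M.
Definition dfst V W : hom (dsum V W) V := fun i => col_mx 1%:M 0.
Definition dsnd V W : hom (dsum V W) W := fun i => col_mx 0 1%:M.

Arguments dinl {V W} i.
Arguments dinr {V W} i.
Arguments dfst {V W} i.
Arguments dsnd {V W} i.

Lemma dinl_hom V W : is_hom (@dinl V W).
Proof. by move=> i;
  rewrite /dinl /= mul_mx_row mul_row_block !mulmx0 !mul0mx mulmx1 mul1mx !addr0. Qed.
Lemma dinr_hom V W : is_hom (@dinr V W).
Proof. by move=> i;
  rewrite /dinr /= mul_mx_row mul_row_block !mulmx0 !mul0mx mulmx1 mul1mx !add0r. Qed.
Lemma dfst_hom V W : is_hom (@dfst V W).
Proof. by move=> i;
  rewrite /dfst /= mul_block_col mul_col_mx !mulmx0 !mul0mx mulmx1 mul1mx !addr0. Qed.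
Lemma dsnd_hom V W : is_hom (@dsnd V W).
Proof. by move=> i;
  rewrite /dsnd /= mul_block_col mul_col_mx !mulmx0 !mul0mx mulmx1 mul1mx !add0r. Qed.

Lemma dinl_dfst V W i : @dinl V W i *m @dfst V W i = 1%:M.
Proof. by rewrite mul_row_col mul1mx mul0mx addr0. Qed.
Lemma dinl_dsnd V W i : @dinl V W i *m @dsnd V W i = 0.
Proof. by rewrite mul_row_col mulmx0 mul0mx addr0. Qed.
Lemma dinr_dfst V W i : @dinr V W i *m @dfst V W i = 0.
Proof. by rewrite mul_row_col mulmx0 mul0mx addr0. Qed.
Lemma dinr_dsnd V W i : @dinr V W i *m @dsnd V W i = 1%:M.
Proof. by rewrite mul_row_col mul1mx mul0mx add0r. Qed.
Lemma dsum_id V W i :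
  @dfst V W i *m @dinl V W i + @dsnd V W i *m @dinr V W i = 1%:M.
Proof.
rewrite /dfst /dsnd /dinl /dinr !mul_col_mx !mul_mx_row !mulmx0 !mulmx1.
by rewrite add_col_mx !add_row_mx !addr0 !add0r -block_mxEv -scalar_mx_block.
Qed.

Lemma dsum_elt V W i m (A : 'M_(m, rdim (dsum V W) i)) :
  A = A *m @dfst V W i *m @dinl V W i + A *m @dsnd V W i *m @dinr V W i.
Proof. by rewrite -!mulmxA -mulmxDr dsum_id mulmx1. Qed.

Definition copair V W X (phi : hom V X) (psi : hom W X) : hom (dsum V W) X :=
  fun i => dfst i *m phi i + dsnd i *m psi i.

Lemma copair_hom V W X (phi : hom V X) (psi : hom W X) :
  is_hom phi -> is_hom psi -> is_hom (copair phi psi).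
Proof.
move=> H1 H2; apply: add_hom.
  by apply: hom_comp_hom H1; apply: dfst_hom.
by apply: hom_comp_hom H2; apply: dsnd_hom.
Qed.

Lemma dinl_copair V W X (phi : hom V X) (psi : hom W X) i :
  @dinl V W i *m copair phi psi i = phi i.
Proof. by rewrite mulmxDr !mulmxA dinl_dfst dinl_dsnd mul1mx mul0mx addr0. Qed.

Lemma dinr_copair V W X (phi : hom V X) (psi : hom W X) i :
  @dinr V W i *m copair phi psi i = psi i.
Proof. by rewrite mulmxDr !mulmxA dinr_dfst dinr_dsnd mul1mx mul0mx add0r. Qed.

Lemma copair_elt V W X (phi : hom V X) (psi : hom W X) i m (A : 'M_(m, _)) :
  A *m copair phi psi i = A *m dfst i *m phi i + A *m dsnd i *m psi i.
Proof. by rewrite mulmxDr !mulmxA. Qed.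

Lemma dsum_isr V W : isr V -> isr W -> isr (dsum V W).
Proof.
move=> [HV0 HV] [HW0 HW]; split=> i Hi /=; first by rewrite HV0 // HW0.
rewrite [LHS]dsum_elt (pmx_hom _ _ (@dfst_hom V W)) (pmx_hom _ _ (@dsnd_hom V W)).
by rewrite HV // HW // !(mulmx0, mul0mx) addr0.
Qed.

Lemma dsum_proj V W : proj V -> proj W -> proj (dsum V W).
Proof.
move=> [HV HV'] [HW HW']; split=> [|M N g h HM HN Hg Hs Hh]; first exact: dsum_isr.
have [l1 [Hl1 E1]] := HV' M N g _ HM HN Hg Hs (hom_comp_hom (@dinl_hom V W) Hh).
have [l2 [Hl2 E2]] := HW' M N g _ HM HN Hg Hs (hom_comp_hom (@dinr_hom V W) Hh).
exists (copair l1 l2); split=> [|i]; first exact: copair_hom.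
by rewrite /copair mulmxDl -!mulmxA E1 E2 /hom_comp !mulmxA -mulmxDl dsum_id mul1mx.
Qed.

(** * Split sequences and projective dimension *)

Lemma ses_split V W X (phi : hom V W) (psi : hom W X) :
  ses phi psi -> isr W -> proj X ->
  exists (s : hom X W) (r : hom W V), [/\ is_hom s, is_hom r,
    forall i, s i *m psi i = 1%:M, forall i, phi i *m r i = 1%:M &
    forall i, r i *m phi i + psi i *m s i = 1%:M].
Proof.
move=> [Hf Hp Hi He Hs] HW [HX HX'].
have [s [Hsh Es]] := HX' _ _ psi _ HW HX Hp Hs (@id_hom X).
(* The projection complementary to [s] lands in the kernel of [psi], so it factors through [phi] and
   yields the retraction. *)
pose e : hom W W := fun i => 1%:M - psi i *m s i.
have He0 : forall i, e i *m psi i = 0.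
  by move=> i; rewrite mulmxBl mul1mx -mulmxA Es mulmx1 subrr.
have Heh : is_hom e by apply: sub_hom (@id_hom W) (hom_comp_hom Hp Hsh).
exists s, (factor phi e).
have HK := factK He He0; split=> //; first exact: factor_hom He _ _.
  move=> i; apply: (inj_cancel Hi); rewrite -mulmxA HK mul1mx mulmxBr mulmx1 mulmxA.
  by have /exactP [-> _] := He; rewrite mul0mx subr0.
by move=> i; rewrite HK subrK.
Qed.

Lemma ses_proj_ext V W X (phi : hom V W) (psi : hom W X) :
  ses phi psi -> isr W -> proj V -> proj X -> proj W.
Proof.
move=> Hses HW HV HX; split=> // M N g h HM HN Hg Hs Hh.
have [s [r [Hsh Hrh _ _ E]]] := ses_split Hses HW HX.
case: Hses => Hf Hp _ _ _.
have [l1 [Hl1 E1]] := HV.2 M N g _ HM HN Hg Hs (hom_comp_hom Hf Hh).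
have [l2 [Hl2 E2]] := HX.2 M N g _ HM HN Hg Hs (hom_comp_hom Hsh Hh).
exists (fun i => r i *m l1 i + psi i *m l2 i); split=> [|i].
  by apply: add_hom; [exact: hom_comp_hom Hrh Hl1 | exact: hom_comp_hom Hp Hl2].
by rewrite mulmxDl -!mulmxA E1 E2 /hom_comp !mulmxA -mulmxDl E mul1mx.
Qed.

Lemma ses_proj_kernel V W X (phi : hom V W) (psi : hom W X) :
  ses phi psi -> proj W -> proj X -> proj V.
Proof.
move=> Hses HW HX.
have [s [r [Hsh Hrh _ E _]]] := ses_split Hses HW.1 HX.
case: Hses => Hf Hp Hi _ _; split=> [|M N g h HM HN Hg Hs Hh].
  exact: sub_isr Hf Hi HW.1.
have [l [Hl El]] := HW.2 M N g _ HM HN Hg Hs (hom_comp_hom Hrh Hh).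
exists (hom_comp phi l); split=> [|i]; first exact: hom_comp_hom.
by rewrite /hom_comp -mulmxA El /hom_comp mulmxA E mul1mx.
Qed.

(** Some presentation is required at each stage, not a minimal one; independence of the choice is
    [pdim_le_syzygy]. *)
Fixpoint pdim_le k (M : rep K) : Prop :=
  if k is k'.+1 then
    exists P L (iota : hom L P) (p : hom P M), [/\ ses iota p, proj P & pdim_le k' L]
  else proj M.

Lemma zero_proj M : (forall i, rdim M i = 0%N) -> proj M.
Proof.
move=> H0; have HE i m (A B : 'M[K]_(rdim M i, m)) : A = B.
  by move: A B; rewrite H0 => A B; rewrite flatmx0 [RHS]flatmx0.
split=> [|M' N g h HM HN Hg Hs Hh]; first by split=> i _ //; apply: HE.
by exists (fun i => 0); split=> [i|i]; apply: HE.
Qed.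

Definition zrep : rep K := Rep (fun i => (0 : 'M_(0, 0))).

Lemma proj_pdim_le k M : proj M -> pdim_le k M.
Proof.
elim: k M => [|k IHk] M HM //=.
exists M, zrep, (fun i => 0), (fun i => 1%:M); split=> //; last first.
  by apply: IHk; apply: zero_proj.
split=> [i||||].
- by rewrite mulmx0 mul0mx.
- exact: id_hom.
- by move=> i /=; rewrite mxrank0.
- by move=> i; rewrite mulmx1 mxrank0 mxrank1.
- by move=> i; rewrite mxrank1.
Qed.

(** Horseshoe lemma: covers of the two ends combine to a cover of [W] whose kernel is an extension
    of the two syzygies. *)
Lemma pdim_le_ext k V W X (phi : hom V W) (psi : hom W X) :
  ses phi psi -> isr W -> pdim_le k V -> pdim_le k X -> pdim_le k W.
Proof.
elim: k V W X phi psi => [|k IHk] V W X phi psi Hses HW /=.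
  exact: ses_proj_ext Hses HW.
move=> [P [A [a [p [Sap HP HA]]]]] [Q [B [b [q [Sbq HQ HB]]]]].
have [Hf Hp Hi He Hs] := Hses.
have [Ha Hph Hai Hae Hps] := Sap.
have [Hb Hqh Hbi Hbe Hqs] := Sbq.
have HX := quot_isr Hp Hs HW.
have [l [Hl El]] := HQ.2 _ _ psi _ HW HX Hp Hs Hqh.
have /exactP [ap0 apE] := Hae.
have /exactP [bq0 bqE] := Hbe.
have /exactP [fp0 fpE] := He.
have /surjP psS := Hps.
pose cv : hom (dsum P Q) W := copair (hom_comp p phi) l.
have Hcv : is_hom cv by apply: copair_hom Hl; apply: hom_comp_hom.
have Ecv i : cv i *m psi i = dsnd i *m q i.
  by rewrite mulmxDl -!mulmxA fp0 !mulmx0 add0r El.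
have Scv : surj cv.
  apply/surjP => i; have /surjP /(_ i) [T HT] := Hqs.
  (* Subtracting a preimage taken through [Q] leaves an element of the image of [V], which is
     covered by [P]. *)
  pose Y := 1%:M - psi i *m T *m l i.
  have HY : Y *m psi i = 0.
    by rewrite mulmxBl mul1mx -!mulmxA El HT mulmx1 subrr.
  have [Z HZ] := fpE _ _ _ HY; have [S HS] := psS i.
  exists (Z *m S *m @dinl P Q i + psi i *m T *m @dinr P Q i).
  rewrite mulmxDl -[X in X + _]mulmxA -[X in _ + X]mulmxA dinl_copair dinr_copair
    /hom_comp.
  rewrite -!mulmxA [S *m _]mulmxA HS mul1mx -HZ /Y -!mulmxA.
  by rewrite subrK.
exists (dsum P Q), (kernel cv), (kernel_inc cv), cv.
split; [exact: kernel_ses | exact: dsum_proj |].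
have Kex := kernel_inc_exact cv; have Kin := kernel_inc_inj cv;
  have Khom := kernel_inc_hom Hcv.
have /exactP [K0 KE] := Kex.
pose al0 : hom A (dsum P Q) := hom_comp a (@dinl P Q).
have al00 i : al0 i *m cv i = 0.
  by rewrite -mulmxA dinl_copair mulmxA ap0 mul0mx.
have Hal0 : is_hom al0 by apply: hom_comp_hom => //; apply: dinl_hom.
pose be0 : hom (kernel cv) Q := hom_comp (kernel_inc cv) (@dsnd P Q).
have be00 i : be0 i *m q i = 0.
  by rewrite -mulmxA -Ecv mulmxA K0 mul0mx.
have Hbe0 : is_hom be0 by apply: hom_comp_hom => //; apply: dsnd_hom.
have alK := factK Kex al00; have beK := factK Hbe be00.
(* These are the maps induced on the kernels, [A] to [kernel cv] to [B]. *)
set al := factor _ _ in alK; set be := factor _ _ in beK.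
apply: (IHk _ _ _ al be) => //; last by apply: kernel_isr => //;
  apply: dsum_isr HP.1 HQ.1.
split; [exact: factor_hom Kex _ _ | exact: factor_hom Hbe _ _ | | |].
- apply/injP => i m Y HY; apply: (inj_cancel Hai); rewrite mul0mx.
  rewrite -[LHS]mulmx1 -(dinl_dfst P Q) !mulmxA.
  have -> : Y *m a i *m @dinl P Q i = Y *m al i *m kernel_inc cv i.
    by rewrite -[RHS]mulmxA alK mulmxA.
  by rewrite HY !mul0mx.
- apply/exactP; split=> [i | i m Y HY].
    apply: (inj_cancel Hbi); rewrite mul0mx -mulmxA beK mulmxA alK.
    by rewrite -mulmxA dinl_dsnd mulmx0.
  have H2 : Y *m kernel_inc cv i *m @dsnd P Q i = 0.
    by rewrite -mulmxA -[_ *m dsnd i]beK mulmxA HY mul0mx.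
  have H3 : Y *m kernel_inc cv i *m @dfst P Q i *m p i = 0.
    apply: (inj_cancel Hi); rewrite mul0mx.
    transitivity (Y *m kernel_inc cv i *m cv i); last by rewrite -mulmxA K0 mulmx0.
    by rewrite copair_elt H2 mul0mx addr0 /hom_comp mulmxA.
  have [Z HZ] := apE _ _ _ H3.
  exists Z; apply: (inj_cancel Kin).
  by rewrite [LHS]dsum_elt H2 mul0mx addr0 HZ -[RHS]mulmxA alK mulmxA.
(* An element of [B], sent to [W] by the lift [l], comes from [V]; correcting it by a preimage in
   [P] gives an element of [kernel cv] above it. *)
- apply/surjP => i.
  have H1 : b i *m l i *m psi i = 0 by rewrite -mulmxA El bq0.
  have [Z HZ] := fpE _ _ _ H1; have [S HS] := psS i.
  have H2 : (b i *m @dinr P Q i - Z *m S *m @dinl P Q i) *m cv i = 0.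
    rewrite mulmxBl -[X in X - _]mulmxA -[X in _ - X]mulmxA dinl_copair dinr_copair
      /hom_comp.
    by rewrite HZ -mulmxA [S *m _]mulmxA HS mul1mx subrr.
  have [T HT] := KE _ _ _ H2.
  exists T; apply: (inj_cancel Hbi).
  rewrite -mulmxA beK mul1mx mulmxA -HT mulmxBl -!mulmxA dinr_dsnd dinl_dsnd.
  by rewrite !mulmx0 subr0 mulmx1.
Qed.

(* For the induction step, a projective cover Q of W restricts to the cover
   ker (Q -> X) of V. *)
Lemma pdim_le_kernel_proj k V W X (phi : hom V W) (psi : hom W X) :
  ses phi psi -> proj X -> pdim_le k W -> pdim_le k V.
Proof.
case: k => [|k] Hses HX /=; first by move=> HW; apply: ses_proj_kernel Hses HW HX.
move=> [Q [L [l [q [Slq HQ HL]]]]].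
have [Hf Hp Hi He Hs] := Hses.
have [Hl Hqh Hli Hle Hqs] := Slq.
have /exactP [lq0 lqE] := Hle.
have /exactP [fp0 fpE] := He.
pose t : hom Q X := hom_comp q psi.
have Ht : is_hom t by apply: hom_comp_hom.
have St : surj t.
  apply/surjP => i; have /surjP /(_ i) [S1 HS1] := Hqs.
  have /surjP /(_ i) [S2 HS2] := Hs.
  by exists (S2 *m S1); rewrite /t /hom_comp -mulmxA [S1 *m _]mulmxA HS1 mul1mx.
have Kex := kernel_inc_exact t; have Kin := kernel_inc_inj t;
  have Khom := kernel_inc_hom Ht.
have /exactP [K0 KE] := Kex.
have al00 i : l i *m t i = 0 by rewrite mulmxA lq0 mul0mx.
pose be0 : hom (kernel t) W := hom_comp (kernel_inc t) q.
have be00 i : be0 i *m psi i = 0 by rewrite -mulmxA K0.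
have Hbe0 : is_hom be0 by apply: hom_comp_hom.
have alK := factK Kex al00; have beK := factK He be00.
set al := factor _ _ in alK; set be := factor _ _ in beK.
exists (kernel t), L, al, be; split=> //; last first.
  by apply: ses_proj_kernel (kernel_ses Ht St) HQ HX.
split; [exact: factor_hom Kex _ _ | exact: factor_hom He _ _ | | |].
- apply/injP => i m Y HY; apply: (inj_cancel Hli).
  by rewrite -alK mulmxA HY !mul0mx.
- apply/exactP; split=> [i | i m Y HY].
    by apply: (inj_cancel Hi); rewrite mul0mx -mulmxA beK mulmxA alK lq0.
  have H2 : Y *m kernel_inc t i *m q i = 0.
    by rewrite -mulmxA -[_ *m q i]beK mulmxA HY mul0mx.
  have [Z HZ] := lqE _ _ _ H2.
  by exists Z; apply: (inj_cancel Kin); rewrite HZ -mulmxA alK.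
- apply/surjP => i; have /surjP /(_ i) [S HS] := Hqs.
  have H1 : phi i *m S *m t i = 0.
    by rewrite /t /hom_comp -mulmxA [S *m _]mulmxA HS mul1mx fp0.
  have [T HT] := KE _ _ _ H1.
  exists T; apply: (inj_cancel Hi).
  by rewrite -mulmxA beK mul1mx /be0 /hom_comp mulmxA -HT -mulmxA HS mulmx1.
Qed.

(** * Pullbacks and Schanuel's argument *)

Section Pullback.
Variables (V V' P P' M : rep K).
Variables (a : hom V P) (p : hom P M) (a' : hom V' P') (p' : hom P' M).
Hypotheses (Sa : ses a p) (Sa' : ses a' p').

(** Its kernel is the pullback of [p] and [p'], an extension of [P] by [V'] and also of [P'] by
    [V]. *)
Let cv : hom (dsum P P') M := copair p (fun i => - p' i).

Lemma pullback_hom : is_hom cv.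
Proof.
case: Sa => _ Hp _ _ _; case: Sa' => _ Hp' _ _ _.
by apply: copair_hom => // i; rewrite mulmxN mulNmx Hp'.
Qed.

Lemma pullback_eltP i m (Y : 'M_(m, _)) :
  Y *m cv i = 0 <-> Y *m @dfst P P' i *m p i = Y *m @dsnd P P' i *m p' i.
Proof.
rewrite copair_elt mulmxN; split=> [/eqP|->]; last exact: subrr.
by rewrite subr_eq0 => /eqP.
Qed.

Lemma pullback_ses1 :
  exists (al : hom V' (kernel cv)) (be : hom (kernel cv) P), ses al be.
Proof.
have Hcv := pullback_hom.
have Kex := kernel_inc_exact cv; have Kin := kernel_inc_inj cv;
  have Khom := kernel_inc_hom Hcv.
have /exactP [K0 KE] := Kex.
have [Ha Hp _ _ Hs] := Sa; have [Ha' Hp' Hi' He' Hs'] := Sa'.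
have /exactP [ap0 apE] := He'.
have al00 i : hom_comp a' (@dinr P P') i *m cv i = 0.
  by rewrite /hom_comp -mulmxA dinr_copair mulmxN ap0 oppr0.
have alK := factK Kex al00; set al := factor _ _ in alK.
exists al, (hom_comp (kernel_inc cv) (@dfst P P')); split.
- by apply: factor_hom Kex _ _ => //; apply: hom_comp_hom => //; apply: dinr_hom.
- by apply: hom_comp_hom => //; apply: dfst_hom.
- apply/injP => i m Y HY; apply: (inj_cancel Hi').
  rewrite -[LHS]mulmx1 -(dinr_dsnd P P') !mulmxA.
  have := alK i; rewrite /hom_comp => {}alK.
  by rewrite -[Y *m _ *m _]mulmxA -alK mulmxA HY !mul0mx.
- apply/exactP; split=> [i | i m Y HY].
    by rewrite /hom_comp mulmxA alK /hom_comp -mulmxA dinr_dfst mulmx0.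
  have H1 : Y *m kernel_inc cv i *m cv i = 0 by rewrite -mulmxA K0 mulmx0.
  move/pullback_eltP: H1; rewrite -[Y *m _ *m dfst i]mulmxA HY mul0mx => /esym.
  move=> /apE [Z HZ]; exists Z; apply: (inj_cancel Kin).
  rewrite [LHS]dsum_elt -[Y *m _ *m dfst i]mulmxA HY mul0mx add0r HZ.
  by rewrite -[RHS]mulmxA alK mulmxA.
- apply/surjP => i; have /surjP /(_ i) [S HS] := Hs'.
  have H1 : (@dinl P P' i + p i *m S *m @dinr P P' i) *m cv i = 0.
    rewrite mulmxDl -[X in _ + X]mulmxA dinl_copair dinr_copair.
    by rewrite mulmxN -mulmxA HS mulmx1 subrr.
  have [T HT] := KE _ _ _ H1; exists T.
  by rewrite /hom_comp mulmxA -HT mulmxDl -mulmxA dinl_dfst dinr_dfst mulmx0 addr0.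
Qed.

Lemma pullback_ses2 :
  exists (al : hom V (kernel cv)) (be : hom (kernel cv) P'), ses al be.
Proof.
have Hcv := pullback_hom.
have Kex := kernel_inc_exact cv; have Kin := kernel_inc_inj cv;
  have Khom := kernel_inc_hom Hcv.
have /exactP [K0 KE] := Kex.
have [Ha Hp Hi He Hs] := Sa; have [Ha' Hp' _ _ Hs'] := Sa'.
have /exactP [ap0 apE] := He.
have al00 i : hom_comp a (@dinl P P') i *m cv i = 0.
  by rewrite /hom_comp -mulmxA dinl_copair ap0.
have alK := factK Kex al00; set al := factor _ _ in alK.
exists al, (hom_comp (kernel_inc cv) (@dsnd P P')); split.
- by apply: factor_hom Kex _ _ => //; apply: hom_comp_hom => //; apply: dinl_hom.
- by apply: hom_comp_hom => //; apply: dsnd_hom.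
- apply/injP => i m Y HY; apply: (inj_cancel Hi).
  rewrite -[LHS]mulmx1 -(dinl_dfst P P') !mulmxA.
  have := alK i; rewrite /hom_comp => {}alK.
  by rewrite -[Y *m _ *m _]mulmxA -alK mulmxA HY !mul0mx.
- apply/exactP; split=> [i | i m Y HY].
    by rewrite /hom_comp mulmxA alK /hom_comp -mulmxA dinl_dsnd mulmx0.
  have H1 : Y *m kernel_inc cv i *m cv i = 0 by rewrite -mulmxA K0 mulmx0.
  move/pullback_eltP: H1; rewrite -[Y *m _ *m dsnd i]mulmxA HY mul0mx.
  move=> /apE [Z HZ]; exists Z; apply: (inj_cancel Kin).
  rewrite [LHS]dsum_elt -[Y *m _ *m dsnd i]mulmxA HY mul0mx addr0 HZ.
  by rewrite -[RHS]mulmxA alK mulmxA.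
- apply/surjP => i; have /surjP /(_ i) [S HS] := Hs.
  have H1 : (p' i *m S *m @dinl P P' i + @dinr P P' i) *m cv i = 0.
    rewrite mulmxDl -[X in X + _]mulmxA dinl_copair dinr_copair.
    by rewrite -mulmxA HS mulmx1 subrr.
  have [T HT] := KE _ _ _ H1; exists T.
  by rewrite /hom_comp mulmxA -HT mulmxDl -mulmxA dinr_dsnd dinl_dsnd mulmx0 add0r.
Qed.

End Pullback.

(** The pullback inherits the bound from [V'] and [P], being an extension of them; as the kernel of
    a surjection from it onto the projective [P'], [V] inherits the bound in turn. *)
Lemma pdim_le_syzygy k V P M (a : hom V P) (p : hom P M) :
  ses a p -> proj P -> pdim_le k.+1 M -> pdim_le k V.
Proof.
move=> Sa HP [P' [V' [a' [p' [Sa' HP' HV']]]]].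
have [al [be S1]] := pullback_ses1 Sa Sa'.
have [al' [be' S2]] := pullback_ses2 Sa Sa'.
apply: (pdim_le_kernel_proj S2 HP'); apply: (pdim_le_ext S1 _ HV' (proj_pdim_le k HP)).
by apply: (kernel_isr (pullback_hom Sa Sa')); apply: dsum_isr HP.1 HP'.1.
Qed.

(** * Comparison with projective resolutions *)

Lemma pdim_le_resolution k M : pdim_le k M -> proj_resolution n c M k.
Proof.
elim: k M => [|k IHk] M /=.
  move=> HM; exists (fun=> M), (fun j i => 1%:M); split=> //.
  by do !split=> //; try (by move=> i; rewrite mxrank1); move=> *; apply: id_hom.
move=> [P [L [a [p [[Ha Hp Hi He Hs] HP /IHk [C [d [E]]]]]]]].
case: L / E a Ha Hi He => a Ha Hi He [Hd [HC [Sd [Ed Id]]]].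
(* Splicing: [M] and [P] are put in front, and the augmentation onto the syzygy is composed with its
   inclusion into [P]. *)
pose C' j := if j is j'.+1 then (if j' is j''.+1 then C j''.+1 else P) else M.
pose d' : forall j, hom (C' j.+1) (C' j) := fun j =>
  match j return hom (C' j.+1) (C' j) with
  | 0 => p | 1 => hom_comp (d 0) a | j''.+2 => d j''.+1 end.
have /exactP [ap0 apE] := He.
have /surjP Sd' := Sd.
exists C', d'; split=> //; split; [|split; [|split=> //; split]].
- by case=> [|[|j]] //= Hj; [apply: hom_comp_hom => //; apply: Hd | apply: Hd].
- by case=> [|[|j]] //= Hj; apply: HC.
- case=> [|[|j]] //= Hj; last exact: Ed.
    apply/exactP; split=> [i | i m Y HY]; first by rewrite /hom_comp -mulmxA ap0 mulmx0.
    have [Z ->] := apE _ _ _ HY; have [S HS] := Sd' i.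
    by exists (Z *m S); rewrite /hom_comp -mulmxA [S *m _]mulmxA HS mul1mx.
  have /exactP [dd0 ddE] := Ed 0%N Hj.
  apply/exactP; split=> [i | i m Y]; first by rewrite /hom_comp mulmxA dd0 mul0mx.
  by rewrite /hom_comp mulmxA => HY; apply: ddE; apply: (inj_cancel Hi); rewrite mul0mx.
- case: k Id {IHk Hd HC Ed} => [|k] //= Id; apply/injP => i m Y.
  rewrite /hom_comp mulmxA => HY; apply: (inj_cancel Id); rewrite mul0mx.
  by apply: (inj_cancel Hi); rewrite mul0mx.
Qed.

Lemma iso_proj V W (phi : hom V W) :
  is_hom phi -> inj phi -> surj phi -> proj V -> proj W.
Proof.
move=> Hh Hi Hs [HV HV']; split=> [|M N g h HM HN Hg Hgs Hhh].
  exact: quot_isr Hh Hs HV.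
have [l [Hl El]] := HV' M N g _ HM HN Hg Hgs (hom_comp_hom Hh Hhh).
have [u HK] : exists u : hom W V, forall i, u i *m phi i = 1%:M.
  by exists (fun i => pinvmx (phi i)) => i; apply: mulVpmx; rewrite /row_full Hs.
exists (fun i => u i *m l i); split=> i; last first.
  by rewrite -mulmxA El /hom_comp mulmxA HK mul1mx.
have -> : rmap W i = u i *m rmap V i *m phi i.+1.
  by rewrite -mulmxA Hh mulmxA HK mul1mx.
have HK' : phi i.+1 *m u i.+1 = 1%:M.
  by apply: (inj_cancel Hi); rewrite -mulmxA HK mulmx1 mul1mx.
by rewrite -!mulmxA [phi i.+1 *m _]mulmxA HK' mul1mx Hl.
Qed.

Lemma resolution_pdim_le k M : proj_resolution n c M k -> pdim_le k M.
Proof.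
elim: k M => [|k IHk] M [C [d [E [Hd [HC [Sd [Ed Id]]]]]]]; case: M / E => /=.
  by apply: iso_proj (Hd _ _) Id Sd _ => //; apply: HC.
have Hd0 := Hd 0%N isT; have Hd1 := Hd 1%N isT.
have Kex := kernel_inc_exact (d 0%N); have Kin := kernel_inc_inj (d 0%N).
have Khom := kernel_inc_hom Hd0.
exists (C 1%N), (kernel (d 0%N)), (kernel_inc (d 0%N)), (d 0%N).
split; [exact: kernel_ses | exact: HC | apply: IHk].
have /exactP [dd0 ddE] := Ed _ (ltn0Sn k).
have fK := factK Kex dd0; set t := factor _ _ in fK.
have Ht : is_hom t by apply: factor_hom Kex _ _.
(* [C 1] is dropped and the first syzygy becomes the resolved module. *)
pose C' j := if j is j'.+1 then C j'.+2 else kernel (d 0%N).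
pose d' : forall j, hom (C' j.+1) (C' j) := fun j =>
  match j return hom (C' j.+1) (C' j) with 0 => t | j''.+1 => d j''.+2 end.
exists C', d'; split=> //; split; [|split; [|split; [|split]]].
- by case=> [|j] //= Hj; apply: Hd; lia.
- by case=> [|j] //= Hj; apply: HC; lia.
- apply/surjP => i; have /exactP [K0 _] := Kex.
  have [B HB] := ddE _ _ _ (K0 i); exists B; apply: (inj_cancel Kin).
  by rewrite -mulmxA fK mul1mx -HB.
- case=> [|j] //= Hj; last by apply: Ed; lia.
  have /exactP [e0 eE] : exact_at (d 2%N) (d 1%N) by apply: Ed; lia.
  apply/exactP; split=> [i | i m Y HY].
    by apply: (inj_cancel Kin); rewrite -mulmxA fK e0 mul0mx.
  by apply: eE; rewrite -fK mulmxA HY mul0mx.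
- case: k Id {Hd HC Ed} => [|k] //= Id; apply/injP => i m Y HY.
  by apply: (inj_cancel Id); rewrite -fK mulmxA HY !mul0mx.
Qed.

Lemma pdim_le_mono k k' M : (k <= k')%N -> pdim_le k M -> pdim_le k' M.
Proof.
elim: k k' M => [|k IHk] k' M; first by move=> _; apply: proj_pdim_le.
case: k' => // k' Hk /= [P [L [a [p [H1 H2 H3]]]]].
by exists P, L, a, p; split=> //; apply: IHk.
Qed.

Lemma pd_leP M m : pd_le n c M m <-> pdim_le m M.
Proof.
split=> [[k [Hk /resolution_pdim_le]] | H]; first exact: pdim_le_mono.
by exists m; split=> //; apply: pdim_le_resolution.
Qed.

End Homological.

(** * Interval modules *)

(* Decides whether the interval module [a, b) has projective dimension at most
   k, by passing to its syzygy [b, f a). *)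
Fixpoint pd_leb (f : nat -> nat) k a b :=
  (b == f a) || (if k is k'.+1 then pd_leb f k' b (f a) else false).

Section Intervals.
Import Defs.
Local Open Scope ring_scope.

Variable K : fieldType.

(** Only the minimum of the three sizes matters, so identities between products of [pid_mx] become
    arithmetic. *)
Lemma pid_mx_min m p r s :
  minn m (minn p r) = minn m (minn p s) -> pid_mx r = pid_mx s :> 'M[K]_(m, p).
Proof. by move=> E; rewrite -pid_mx_minh -pid_mx_minv E pid_mx_minv pid_mx_minh. Qed.

Lemma mxrank_pid m p r : \rank (pid_mx r : 'M[K]_(m, p)) = minn m (minn p r).
Proof.
rewrite -(@pid_mx_min _ _ (minn m (minn p r)) r); last by lia.
by rewrite rank_pid_mx; lia.
Qed.

Lemma pid_mx_eq0 m p r : minn m (minn p r) = 0%N -> pid_mx r = 0 :> 'M[K]_(m, p).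
Proof. by move=> E; rewrite -(pid_mx_0 K m p); apply: pid_mx_min; lia. Qed.

(** This is [d] copies of the interval module; multiplicities occur because the filtration of a
    module splits off a whole vertex space at a time. *)
Definition intv a b d : rep K :=
  Rep (fun i => pid_mx d :
    'M_(if a <= i < b then d else 0, if a <= i.+1 < b then d else 0)%N).

Definition pid_hom d (V W : rep K) : hom V W := fun i => pid_mx d.

(** A square can fail to commute only if its two end corners are nonzero; the hypothesis then makes
    both middle corners nonzero. *)
Lemma intv_hom a b a' b' d :
  (forall i, a <= i < b -> a' <= i.+1 < b' -> (a <= i.+1 < b) && (a' <= i < b'))%N ->
  is_hom (pid_hom d (intv a b d) (intv a' b' d)).
Proof.
move=> H i; rewrite /pid_hom /= !mul_pid_mx; apply: pid_mx_min.
have := H i; by do 4!(case: ifP => ?); lia.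
Qed.

Lemma intv_ses a b e d : (a <= b <= e)%N ->
  ses (pid_hom d (intv b e d) (intv a e d)) (pid_hom d (intv a e d) (intv a b d)).
Proof.
move=> Habe; split; try (by apply: intv_hom => i; lia).
- by move=> i; rewrite /pid_hom mxrank_pid /=; do 2!(case: ifP => ?); lia.
- move=> i; rewrite /pid_hom mul_pid_mx !mxrank_pid; split.
    by apply: pid_mx_eq0 => /=; do 3!(case: ifP => ?); lia.
  by rewrite /=; do 3!(case: ifP => ?); lia.
- by move=> i; rewrite /pid_hom mxrank_pid /=; do 2!(case: ifP => ?); lia.
Qed.

Variables (n : nat) (c : nat -> nat).
Let f i := (i + c i)%N.
Hypothesis f_bounds : forall i, (i < n)%N -> (i < f i <= n)%N.
Hypothesis f_mono : forall i j, (i <= j < n)%N -> (f i <= f j)%N.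

Notation isr := (@is_rep K n c).
Notation proj := (@projective K n c).
Notation pdim_le := (@pdim_le K n c).

Lemma intv_isr a b d : (a < n)%N -> (b <= f a)%N -> isr (intv a b d).
Proof.
move=> Ha Hb; split=> i Hi; first by rewrite /=; case: ifP => // ?;
  have := f_bounds Ha; lia.
move: (pmx _ _ _) => /=; case: (boolP (a <= i < b)%N) => Hi1 A; last exact: flatmx0.
have := f_mono (i := a) (j := i); rewrite {2}/f.
move: A; case: ifP => Hi2 A; last by rewrite thinmx0.
by move=> H; exfalso; lia.
Qed.

(** The module is generated freely by [d] elements at [a], subject only to the path of length [c a]
    being zero, which holds in every [M]. *)
Lemma intv_proj a d : (a < n)%N -> proj (intv a (f a) d).
Proof.
move=> Ha; have Hir : isr (intv a (f a) d) by apply: intv_isr.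
split=> // M N g h HM HN Hg Hs Hh.
have /surjP HsS := Hs.
pose x i := (pid_mx d : 'M_(d, rdim (intv a (f a) d) i)) *m h i *m pinvmx (g i).
have xg i : x i *m g i = pid_mx d *m h i.
  by rewrite /x mulmxKpV //; apply: submx_full; rewrite /row_full Hs.
(* [q] restarts at [a] with lifts of the generators and then follows the arrows; its values before
   [a] are immaterial. *)
pose q := fix q i : 'M[K]_(d, rdim M i) :=
  if i is i'.+1 then (if i'.+1 == a then x i'.+1 else q i' *m rmap M i') else x 0%N.
have qa j : j = a -> q j = x j by case: j => //= j /eqP ->.
have qS i : (a <= i)%N -> q i.+1 = q i *m rmap M i.
  by move=> Hi /=; case: eqP => // E; exfalso; lia.
have q_end : q (f a) = 0.
  by rewrite /f (@pmx_fam _ _ _ q) => [|j Hj]; [rewrite HM.2 ?mulmx0 | apply: qS; lia].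
have qg i : (a <= i < f a)%N -> q i *m g i = pid_mx d *m h i.
  elim: i => [|i IHi] Hi.
    have E : a = 0%N by lia.
    by rewrite qa ?xg.
  case: (altP (a =P i.+1)) => [<-|Hai]; first by rewrite qa ?xg.
  rewrite qS -?mulmxA ?Hg ?mulmxA ?IHi -?mulmxA -?Hh; try lia.
  rewrite mulmxA /= mul_pid_mx; congr (_ *m _); apply: pid_mx_min.
  by do 2!(case: ifP => ?); lia.
exists (fun i => pid_mx d *m q i); split=> i.
  have [Hi|Hi] := boolP (a <= i < f a)%N; last first.
    by move: (_ *m _) (_ *m _) => /=; rewrite (negbTE Hi) => A B;
      rewrite flatmx0 [RHS]flatmx0.
  rewrite mulmxA mul_pid_mx -mulmxA -qS; last by lia.
  have [Hi'|Hi'] := boolP (i.+1 < f a)%N.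
    congr (_ *m _); apply: pid_mx_min => /=; by do 2!(case: ifP => ?); lia.
  have E : i.+1 = f a by lia.
  by rewrite E q_end !mulmx0.
have [Hi|Hi] := boolP (a <= i < f a)%N; last first.
  by move: (_ *m _) (h i) => /=; rewrite (negbTE Hi) => A B; rewrite flatmx0 [RHS]flatmx0.
rewrite -mulmxA qg // mulmxA mul_pid_mx -[RHS]mul1mx; congr (_ *m _).
by rewrite -pid_mx_1; apply: pid_mx_min => /=; case: ifP => ?; lia.
Qed.

Lemma intv_not_proj a b : (a < b < f a)%N -> (a < n)%N -> ~ proj (intv a b 1).
Proof.
move=> Hab Ha [Hr HP].
have [_ Hp _ _ Hs] := @intv_ses a b (f a) 1%N ltac:(lia).
have [s [Hsh Es]] :=
  HP _ _ _ _ (intv_isr 1 Ha (leqnn _)) Hr Hp Hs (@id_hom _ (intv a b 1)).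
(* At the last vertex of [[a, b)] the surjection factors through the next arrow of [[a, f a)]. That
   arrow is zero in [[a, b)], so a section would make the identity vanish there. *)
have {}Es := Es b.-1; have {}Hsh := Hsh b.-1.
have E1 : pid_hom 1 (intv a (f a) 1) (intv a b 1) b.-1 =
     rmap (intv a (f a) 1) b.-1 *m pid_mx 1.
  rewrite /pid_hom mul_pid_mx; apply: pid_mx_min => /=.
  by do 3!(case: ifP => ?); lia.
have E2 : rmap (intv a b 1) b.-1 = 0.
  by apply: pid_mx_eq0 => /=; do 2!(case: ifP => ?); lia.
move: Es; rewrite E1 mulmxA -Hsh E2 !mul0mx => /(congr1 (fun A => \rank A)).
by rewrite mxrank0 mxrank1 /=; case: ifP => ?; lia.
Qed.

Lemma intv_pdim_le k a b d : (a < b <= f a)%N -> (a < n)%N ->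
  pd_leb f k a b -> pdim_le k (intv a b d).
Proof.
elim: k a b => [|k IHk] a b Hab Ha /= /orP [/eqP -> | H] //.
- exact: intv_proj.
- by apply: (@proj_pdim_le _ _ _ k.+1); apply: intv_proj.
have [E|Hne] := eqVneq b (f a).
  by rewrite E; apply: (@proj_pdim_le _ _ _ k.+1); apply: intv_proj.
have := f_bounds Ha => Hfa; have := f_mono (i := a) (j := b) => Hfab.
exists (intv a (f a) d), (intv b (f a) d), (pid_hom d _ _), (pid_hom d _ _).
split; [apply: intv_ses; lia | exact: intv_proj | apply: IHk => //; lia].
Qed.

Lemma pdim_le_intv k a b : (a < b <= f a)%N -> (a < n)%N ->
  pdim_le k (intv a b 1) -> pd_leb f k a b.
Proof.
elim: k a b => [|k IHk] a b Hab Ha H /=; case: eqP => //= Hne.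
  by exfalso; apply: intv_not_proj H => //; lia.
have := f_bounds Ha => Hfa; have := f_mono (i := a) (j := b) => Hfab.
apply: IHk; try lia.
by apply: (pdim_le_syzygy (intv_ses 1 _) (intv_proj 1 Ha) H); lia.
Qed.

(** If [M] vanishes below [i0], its space at [i0] is a quotient, a sum of copies of a simple, and
    the kernel vanishes at one more vertex. *)
Lemma simple_filtration k :
  (forall i d, (i < n)%N -> pdim_le k (intv i i.+1 d)) ->
  forall M, isr M -> pdim_le k M.
Proof.
move=> HS M HM.
suff H : forall j M, isr M -> (j <= n)%N ->
    (forall i, (i < n - j)%N -> rdim M i = 0%N) -> pdim_le k M.
  by apply: (H n) => // i; lia.
elim=> [|j IHj] {HM}M HM Hj H0.
  apply: proj_pdim_le; apply: zero_proj => i; have [?|?] := ltnP i n; last exact: HM.1.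
  by apply: H0; lia.
pose i0 := (n - j.+1)%N; have Hi0 : (i0 < n)%N by lia.
pose d := rdim M i0.
have H0' i : (i < i0)%N -> rdim M i = 0%N by move=> Hi; apply: H0; lia.
pose phi : hom M (intv i0 i0.+1 d) := fun i => pid_mx d.
have Hphi : is_hom phi.
  move=> i; have [Hi|Hi] := ltnP i i0.
    move: (_ *m _) (_ *m _); rewrite H0' // => A B; by rewrite flatmx0 [RHS]flatmx0.
  have E : rdim (intv i0 i0.+1 d) i.+1 = 0%N by rewrite /=; case: ifP => //; lia.
  by move: (_ *m _) (_ *m _); rewrite E => A B; rewrite thinmx0 [RHS]thinmx0.
have Sphi : surj phi.
  move=> i; rewrite /phi mxrank_pid /=; case: ifP => Hi; last by lia.
  have -> : i = i0 by lia.
  by rewrite /d !minnn.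
have kerS := kernel_ses Hphi Sphi.
apply: (pdim_le_ext kerS HM _ (HS _ _ Hi0)).
apply: IHj; [exact: kernel_isr | lia |] => i Hi /=.
rewrite mxrank_ker /phi mxrank_pid /=; case: ifP => Hi'.
  have -> : i = i0 by lia.
  by rewrite /d !minnn subnn.
by rewrite H0'; lia.
Qed.

Lemma gldim_leP m :
  gldim_le K n c m <-> forall i, (i < n)%N -> pd_leb f m i i.+1.
Proof.
split=> H.
  move=> i Hi; have Hfi := f_bounds Hi.
  apply: pdim_le_intv => //; first by lia.
  by apply/pd_leP; apply: H; apply: intv_isr => //; lia.
move=> M HM; apply/pd_leP; apply: simple_filtration => // i d Hi.
by apply: intv_pdim_le => //; [have := f_bounds Hi; lia | apply: H].
Qed.

End Intervals.

(** The recursion only applies [f] and compares entries, so it is invariant under an injective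
    relabelling. This serves for second syzygies, for blocks of a disconnected algebra and for
    changes outside the range. *)
Lemma pd_leb_transfer (f g e : nat -> nat) N k a b :
  (forall i, i < N -> i < f i <= N) ->
  (forall i j, i <= j < N -> f i <= f j) ->
  (forall i j, i <= N -> j <= N -> e i = e j -> i = j) ->
  (forall i, i < N -> g (e i) = e (f i)) ->
  a < N -> a < b <= f a ->
  pd_leb g k (e a) (e b) = pd_leb f k a b.
Proof.
move=> Hf Hm He Hg; elim: k a b => [|k IHk] a b Ha Hab /=; have Hfa := Hf _ Ha.
  by rewrite Hg // !orbF; apply/eqP/eqP => [/He->|->] //; lia.
rewrite Hg //; have [->|Hne] := eqVneq b (f a); first by rewrite eqxx.
have -> : (e b == e (f a)) = false.
  by apply/eqP => /He E; move/eqP: Hne; apply; apply: E; lia.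
by apply: IHk; [lia | have := Hm a b; lia].
Qed.

Definition gld_leb (f : seq nat) k :=
  all (fun i => pd_leb (nth 0 f) k i i.+1) (iota 0 (size f)).

Lemma gld_lebP f k :
  reflect (forall i, i < size f -> pd_leb (nth 0 f) k i i.+1) (gld_leb f k).
Proof. by apply: (iffP allP) => H i; have := H i; rewrite mem_iota. Qed.

(** * Dyck words *)

Fixpoint dyck_from h (s : seq bool) :=
  if s is x :: t then (if x then dyck_from h.+1 t else (0 < h) && dyck_from h.-1 t)
    else h == 0.

Fixpoint height_from h (s : seq bool) :=
  if s is x :: t then maxn h (height_from (if x then h.+1 else h.-1) t) else h.

Fixpoint ups_before acc (s : seq bool) :=
  if s is x :: t then (if x then ups_before acc.+1 t else acc :: ups_before acc t)
    else [::].

Fixpoint word_from acc (f : seq nat) :=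
  if f is x :: t then nseq (x - acc) true ++ false :: word_from x t else [::].

(* In [peaks] and [high_peaks] the flag tells whether the word is preceded by an
   up step, which for [high_peaks] must start at positive height. *)
Fixpoint peaks up (s : seq bool) : nat :=
  if s is x :: t then (up && ~~ x) + peaks x t else 0.

Fixpoint high_peaks h up (s : seq bool) : nat :=
  if s is x :: t then
    (if x then high_peaks h.+1 (0 < h) t else up + high_peaks h.-1 false t) else 0.

Lemma height_ge h s : h <= height_from h s.
Proof. by case: s => //= x t; exact: leq_maxl. Qed.

Lemma dyck_cat k h s t : dyck_from k s -> dyck_from (k + h) (s ++ t) = dyck_from h t.
Proof.
elim: s k => [|[] s IHs] k /=; first by move=> /eqP ->.
  by move=> /IHs <-.
by case: k => // k /IHs <-.
Qed.

Lemma dyck_count h s : dyck_from h s -> count negb s = h + count id s.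
Proof.
elim: s h => [|[] s IHs] h /=; first by move=> /eqP ->.
  by move=> /IHs ->; lia.
by case: h => // h /IHs ->; lia.
Qed.

Lemma size_count s : size s = count id s + count negb s.
Proof. by elim: s => //= [[]] s ->; lia. Qed.

Lemma dyck_last h s b : dyck_from h s -> last b s = b && nilp s.
Proof.
elim: s h b => [|x s IHs] h b /=; first by rewrite andbT.
rewrite andbF; case: x => [|] H; last by case/andP: H => _ /IHs ->.
by rewrite (IHs _ _ H); case: s H {IHs}.
Qed.

(** Locates the down step closing the first prime factor once its opening up step is removed. *)
Fixpoint first_return h (s : seq bool) :=
  if s is x :: t then
    if x then (first_return h.+1 t).+1 else (if h is h'.+1 then (first_return h'
      t).+1 else 0)
  else 0.

Lemma fr_cat k s t : dyck_from k s -> first_return k (s ++ false :: t) = size s.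
Proof.
elim: s k => [|[] s IHs] k /=; first by move=> /eqP ->.
  by move=> /IHs ->.
by case: k => // k /IHs ->.
Qed.

Lemma dyck_split k h t : dyck_from (k + h.+1) t ->
  exists r s, [/\ t = r ++ false :: s, dyck_from k r & dyck_from h s].
Proof.
elim: t k => [|[] t IHt] k /=; first by rewrite addnS.
  by move=> /(IHt k.+1) [r [s [-> H1 H2]]]; exists (true :: r), s.
case: k => [|k] /andP [_ H]; first by exists [::], t.
by have [r [s [-> H1 H2]]] := IHt k H; exists (false :: r), s.
Qed.

Variant dyck_spec : seq bool -> Prop :=
| DyckNil : dyck_spec [::]
| DyckCons r s of dyck_from 0 r & dyck_from 0 s : dyck_spec (true :: r ++ false :: s).

Lemma dyckP s : dyck_from 0 s -> dyck_spec s.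
Proof.
case: s => [|[] //= t] => [_|/(@dyck_split 0) [r [s [-> H1 H2]]]]; by constructor.
Qed.

Lemma height_cat k h s t : dyck_from k s ->
  height_from (k + h) (s ++ t) = maxn (h + height_from k s) (height_from h t).
Proof.
elim: s k => [|x s IHs] k /=.
  by move=> /eqP ->; rewrite add0n; have := height_ge h t; lia.
case: x => [/IHs|]; first by rewrite addSn => ->; lia.
by case: k => // k /IHs /= ->; lia.
Qed.

Lemma height_prime r s : dyck_from 0 r ->
  height_from 0 (true :: r ++ false :: s) = maxn (height_from 0 r).+1 (height_from 0 s).
Proof. by move=> /(@height_cat 0 1 r (false :: s)) /= ->; have := height_ge 0 r; lia. Qed.

Lemma ups_before_cat acc s t : ups_before acc (s ++ t) =
  ups_before acc s ++ ups_before (acc + count id s) t.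
Proof.
elim: s acc => [|[] s IHs] acc /=; first by rewrite addn0.
  by rewrite IHs; congr (_ ++ ups_before _ _); lia.
by rewrite IHs add0n.
Qed.

Lemma size_ups_before acc s : size (ups_before acc s) = count negb s.
Proof. by elim: s acc => [|[] s IHs] acc //=; rewrite IHs. Qed.

Lemma ups_before_shift d acc s :
  ups_before (d + acc) s = [seq d + x | x <- ups_before acc s].
Proof. by elim: s acc => [|[] s IHs] acc //=; rewrite -?addnS IHs. Qed.

Lemma ups_before_path acc s : path leq acc (ups_before acc s).
Proof.
elim: s acc => [|[] s IHs] acc //=; last by rewrite leqnn IHs.
have := IHs acc.+1; case: (ups_before _ _) => //= x t /andP [H ->].
by rewrite (ltnW H).
Qed.

(** The height just before a down step is positive. *)
Lemma ups_before_ge acc h s i : dyck_from h s -> i < size (ups_before acc s) ->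
  i + acc < nth 0 (ups_before acc s) i + h.
Proof.
elim: s acc h i => [|[] s IHs] acc h i //=; first by move=> /IHs H /H; lia.
case: h => //= h H; case: i => [|i] /=; first by lia.
by move=> /(IHs _ _ _ H); lia.
Qed.

Lemma ups_before_le acc s i : i < size (ups_before acc s) ->
  nth 0 (ups_before acc s) i <= acc + count id s.
Proof.
elim: s acc i => [|[] s IHs] acc i //=; first by move=> /IHs; lia.
by case: i => [|i] /=; [lia | move=> /IHs; lia].
Qed.

(** Up steps after the last down step leave no trace in [ups_before], hence the final down step. *)
Lemma word_from_ups_before p acc s : p <= acc ->
  word_from p (ups_before acc (rcons s false)) = nseq (acc - p) true ++ rcons s false.
Proof.
elim: s p acc => [|[] s IHs] p acc Hp //=; last by rewrite IHs // subnn.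
by rewrite IHs ?(leqW Hp) // subSn // -addn1 nseqD -catA.
Qed.

(** * Words spread over positions, and their gaps *)

(* The letter of a position: whether it carries an up step, then a down step. *)
Notation letter := (bool * bool)%type.

Fixpoint flat (a : seq letter) : seq bool :=
  if a is (b, v) :: t then nseq b true ++ nseq v false ++ flat t else [::].

(** The height is tested before the up step of the same position. Therefore a peak at ground level
    cannot share a position, which is why only peaks of positive height are special. *)
Fixpoint balanced h (a : seq letter) :=
  match a with
  | [::] => h == 0
  | (b, v) :: t => (v ==> (0 < h)) && balanced (h + b - v) t
  end.

(* Numbers of empty positions between consecutive letters of [flat a].  At a peak
   of positive height the entry is 0 if its two steps share a position and is
   otherwise increased by one. *)
Fixpoint gaps h (up : bool) acc (a : seq letter) : seq nat :=
  match a with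
  | [::] => [:: acc]
  | (true, true) :: t => [:: acc, 0 & gaps h false 0 t]
  | (true, false) :: t => acc :: gaps h.+1 (0 < h) 0 t
  | (false, true) :: t => (acc + up) :: gaps h.-1 false 0 t
  | (false, false) :: t => gaps h up acc.+1 t
  end.

(** Inverse of [gaps]: at positive height, a zero entry between an up step and a down step means
    that both share a position. *)
Fixpoint ungaps h (up : bool) (s : seq bool) (w : seq nat) : seq letter :=
  match s, w with
  | true :: s1, x :: w1 => nseq x (false, false) ++
      match s1, w1 with
      | false :: s2, 0 :: w2 =>
          if 0 < h then (true, true) :: ungaps h false s2 w2
          else (true, false) :: ungaps h.+1 (0 < h) s1 w1
      | _, _ => (true, false) :: ungaps h.+1 (0 < h) s1 w1
      end
  | false :: s1, x :: w1 =>
      nseq (x - up) (false, false) ++ (false, true) :: ungaps h.-1 false s1 w1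
  | [::], x :: _ => nseq x (false, false)
  | _, _ => [::]
  end.

Lemma dyck_flat h a : balanced h a -> dyck_from h (flat a).
Proof.
elim: a h => [|[[] []] a IHa] h //=.
- by case/andP=> /= _; rewrite addnK => /IHa.
- by rewrite addn1 subn0 => /IHa.
- by case/andP=> /= ->; rewrite addn0 subn1 => /IHa.
- by rewrite addn0 subn0 => /IHa.
Qed.

Lemma size_gaps h up acc a : size (gaps h up acc a) = (size (flat a)).+1.
Proof. by elim: a h up acc => [|[[] []] a IHa] h up acc //=; rewrite IHa. Qed.

(** Each peak of positive height gives an excess of one on the right: a shared one has two steps in
    one position, a separated one has its entry raised. The sum of the gaps is thus independent of
    the placement. *)
Lemma sumn_gaps h up acc a : balanced h a ->
  size a + acc + high_peaks h up (flat a) = sumn (gaps h up acc a) + size (flat a).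
Proof.
elim: a h up acc => [|[[] []] a IHa] h up acc /=; first by lia.
- by case/andP=> -> H /=; have := IHa _ false 0 H; rewrite addnK; lia.
- by rewrite addn1 subn0 => H; have := IHa _ (0 < h) 0 H; lia.
- by case/andP=> _; rewrite addn0 subn1 => H; have := IHa _ false 0 H; lia.
- by rewrite addn0 subn0 => H; have := IHa _ up acc.+1 H; lia.
Qed.

(** Separated peaks have a positive entry, so they cannot be mistaken for shared ones. *)
Lemma flat_false h acc a s : flat a = false :: s ->
  0 < head 0 (gaps h true acc a).
Proof.
elim: a acc => [|[[] []] a IHa] acc //= H; first by rewrite addn1.
exact: IHa.
Qed.

Lemma gapsK h up acc a : balanced h a ->
  ungaps h up (flat a) (gaps h up acc a) = nseq acc (false, false) ++ a.
Proof.
elim: a h up acc => [|[[] []] a IHa] h up acc /=; first by rewrite cats0.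
- by case/andP=> /= Hh; rewrite addnK Hh => /IHa ->.
- rewrite addn1 subn0 => /= /IHa H; congr (_ ++ _).
  rewrite H; case E: (flat a) => [|[] s] //; case: ltnP => _.
    by have := flat_false h.+1 0 E; case: (gaps _ _ _ _) => [|[|x] w].
  by case: (gaps _ _ _ _) => [|[|x] w].
- by case/andP=> /= _; rewrite addn0 subn1 addnK => /IHa ->.
- by rewrite addn0 subn0 => /IHa ->; rewrite -addn1 nseqD -catA.
Qed.

(** * Insertion and deletion of peaks *)

Definition add_peaks k s := iter k (fun t => [:: true, false & t]) s.

(* Inserts the prescribed numbers of peaks into the gaps of [s], and one more into
   each peak of [s], so that the inserted peaks are exactly those of the result. *)
Fixpoint build (up : bool) (s : seq bool) (w : seq nat) : seq bool :=
  if s is x :: t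
  then add_peaks (head 0 w + (up && ~~ x)) (x :: build x t (behead w))
  else add_peaks (head 0 w) [::].

(** Deletes all peaks; [acc] counts those passed since the last surviving step, and [up] tells
    whether that step goes up. A surviving down step after it then discounts the extra peak of
    [build]. *)
Fixpoint unbuild (up : bool) acc (s : seq bool) : seq bool * seq nat :=
  match s with
  | [::] => ([::], [:: acc])
  | false :: t => let r := unbuild false 0 t in (false :: r.1, acc - up :: r.2)
  | true :: t =>
      match t with
      | false :: t' => unbuild up acc.+1 t'
      | _ => let r := unbuild true 0 t in (true :: r.1, acc :: r.2)
      end
  end.

Lemma dyck_add_peaks h k s : dyck_from h (add_peaks k s) = dyck_from h s.
Proof. by elim: k. Qed.

Lemma height_add_peaks h k s : height_from h (add_peaks k s) =
  if 0 < k then maxn h.+1 (height_from h s) else height_from h s.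
Proof.
elim: k => //= k ->; have := height_ge h s; have := height_ge h (add_peaks k s).
by case: k => [|k] /=; lia.
Qed.

Lemma dyck_build h up s w : dyck_from h (build up s w) = dyck_from h s.
Proof.
elim: s h up w => [|x s IHs] h up w /=; rewrite dyck_add_peaks //=.
by case: x; rewrite IHs.
Qed.

Lemma size_add_peaks k s : size (add_peaks k s) = k.*2 + size s.
Proof. by elim: k => //= k ->. Qed.

Lemma size_build up s w : size w = (size s).+1 ->
  size (build up s w) = size s + (sumn w + peaks up s).*2.
Proof.
elim: s up w => [|x s IHs] up [|y w] //=; rewrite size_add_peaks.
  by case: w => //=; lia.
by move=> [] /(IHs x) /= ->; lia.
Qed.

Lemma peaks_add_peaks up k s : peaks up (add_peaks k s) = k + peaks (up && (k == 0)) s.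
Proof.
elim: k up => [|k IHk] up /=; first by rewrite andbT.
by rewrite andbF IHk.
Qed.

Lemma peaks_build up s w : size w = (size s).+1 ->
  peaks up (build up s w) = sumn w + peaks up s.
Proof.
elim: s up w => [|x s IHs] up [|y w] //=; rewrite peaks_add_peaks.
  by case: w => //=; lia.
move=> [] /(IHs x) /= ->; case: up; case: x => /=; rewrite ?andbF /=; try lia.
Qed.

Lemma unbuild_add_peaks up acc k s :
  unbuild up acc (add_peaks k s) = unbuild up (acc + k) s.
Proof. by elim: k acc => [|k IHk] acc /=; rewrite ?addn0 // IHk addSnnS. Qed.

(** After a surviving up step no down step follows at once, so [unbuild] does not delete that
    step. *)
Lemma build_up s w : ohead (build true s w) != Some false.
Proof.
case: s => [|x s] /=; first by case: (head 0 w).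
by case: x => /=; rewrite ?addn0 ?addn1 //; case: (head 0 w).
Qed.

Lemma unbuild_up up acc t : ohead t != Some false ->
  unbuild up acc (true :: t) =
  (true :: (unbuild true 0 t).1, acc :: (unbuild true 0 t).2).
Proof. by case: t => [|[]]. Qed.

Lemma buildK up acc s w : size w = (size s).+1 ->
  unbuild up acc (build up s w) = (s, acc + head 0 w :: behead w).
Proof.
elim: s up acc w => [|x s IHs] up acc [|y w] //=; rewrite unbuild_add_peaks.
  by case: w.
move=> [Hw]; have := IHs x 0 w Hw; rewrite add0n.
have Ew : head 0 w :: behead w = w by case: w Hw.
rewrite Ew; case: x => E.
  by rewrite unbuild_up ?build_up // E andbF addn0.
by rewrite /= E andbT addnA addnK.
Qed.

(** Each peak of [s] receives a further peak on top. The [maxn] covers words that never rise above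
    the starting level, where possibly nothing is inserted. *)
Lemma height_build h up s w : dyck_from h s ->
  maxn h.+1 (height_from h (build up s w)) = (height_from h s).+1.
Proof.
elim: s h up w => [|x s IHs] h up w Hs /=; rewrite height_add_peaks /=.
  by case: ifP => _ /=; lia.
case: x Hs => /= [Hs|]; last first.
  by case: h => // h /andP [_ Hs]; have /= := IHs _ false (behead w) Hs; case: ifP; lia.
have := IHs _ true (behead w) Hs; rewrite andbF addn0.
suff : h.+2 <= height_from h.+1 (build true s (behead w)) by case: ifP; lia.
case: s Hs {IHs} => // x s _; have := build_up (x :: s) (behead w).
have : size (build true (x :: s) (behead w)) > 0 by rewrite /= size_add_peaks /=; lia.
case: (build _ _ _) => [|[] t] //= _ _; have := height_ge h.+2 t; lia.
Qed.

Lemma height_build_leq s w k : dyck_from 0 s -> size w = (size s).+1 ->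
  (height_from 0 (build false s w) <= k.+1) = (height_from 0 s <= k).
Proof.
move=> Hs Hw; have := height_build false w Hs; lia.
Qed.

(** * Counting on initial segments *)

Lemma count_iotaS (P : pred nat) p :
  count P (iota 0 p.+1) = count P (iota 0 p) + P p.
Proof. by rewrite -addn1 iotaD count_cat /= addn0. Qed.

Lemma count_iota_lt (P : pred nat) N j : j < count P (iota 0 N) ->
  exists i, [/\ i < N, P i & count P (iota 0 i) = j].
Proof.
elim: N => [|N IHN] //; rewrite count_iotaS.
have [/IHN [i [Hi H1 H2]] _|H1] := ltnP j (count P (iota 0 N)).
  by exists i; split=> //; apply: ltnW.
by case: (boolP (P N)) => HP H2; [exists N; split=> //; lia | lia].
Qed.

Lemma ups_before_flat (B W : pred nat) s k :
  ups_before (count B (iota 0 s)) (flat [seq (B i, W i) | i <- iota s k]) =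
  [seq count B (iota 0 i.+1) | i <- iota s k & W i].
Proof.
elim: k s => [|k IHk] s //=; have := IHk s.+1; rewrite count_iotaS.
have ES := count_iotaS B s.
case EB: (B s) ES; case: (W s) => ES; rewrite ?addn0 ?addn1 /= => -> //;
  by congr (_ :: _); rewrite -[RHS]/(count B (iota 0 s.+1)) ES ?addn0 ?addn1.
Qed.

Lemma balanced_iota (B W : pred nat) s k :
  (forall i, i < s + k -> count W (iota 0 i.+1) <= count B (iota 0 i)) ->
  count W (iota 0 (s + k)) = count B (iota 0 (s + k)) ->
  balanced (count B (iota 0 s) - count W (iota 0 s)) [seq (B i, W i) | i <- iota s k].
Proof.
elim: k s => [|k IHk] s H; first by rewrite addn0 => /= ->; rewrite subnn.
rewrite addnS -addSn => E /=.
have Hs := H s ltac:(lia); rewrite count_iotaS in Hs.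
have := IHk s.+1; rewrite (count_iotaS B s) (count_iotaS W s) => {}IHk.
apply/andP; split; first by apply/implyP => Hw; rewrite Hw in Hs; lia.
rewrite [X in balanced X]( _ : _ =
  count B (iota 0 s) + B s - (count W (iota 0 s) + W s)); last by lia.
by apply: IHk => // i Hi; apply: H; lia.
Qed.

(** * The syzygy-filtered algebra *)

Section Nakayama.

(** The list of all f(i) = i + c_i for an algebra that may be disconnected. *)
Record nakayama (f : seq nat) : Prop := Nak {
  nakayama_sorted : sorted leq f;
  nakayama_bounds : forall i, i < size f -> i < nth 0 f i <= size f }.

Definition connected (f : seq nat) := forall i, i.+1 < size f -> i.+1 < nth 0 f i.

Definition ascent f i := nth 0 f i < nth 0 f i.+1.
Definition ascents f p := count (ascent f) (iota 0 p).
Definition values (f : seq nat) := filter (mem f) (iota 1 (size f)).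
Definition letters f := [seq (ascent f i, i.+1 \in f) | i <- iota 0 (size f).-1].
(* The endomorphism algebra of the projectives covering second syzygies. *)
Definition eps f := ups_before 0 (flat (letters f)).

Lemma nakayama_mono f i j : nakayama f -> i <= j < size f -> nth 0 f i <= nth 0 f j.
Proof.
move=> [Hs _] Hij; apply: (sorted_leq_nth leq_trans leqnn) => //;
  by rewrite ?inE; lia.
Qed.

(** Each strict ascent moves to the next distinct value. *)
Lemma undup_asc f p : sorted leq f -> p < size f ->
  nth 0 f p = nth 0 (undup f) (ascents f p).
Proof.
elim: f p => [|x [|y f] IHf] p //; first by case: p.
move=> /= /andP [Hxy Hf] Hp.
have Hin : (x \in y :: f) = (x == y).
  apply/idP/eqP => [|->]; last by rewrite mem_head.
  have /allP H := order_path_min leq_trans Hf.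
  by rewrite inE => /orP [/eqP //|/H]; lia.
rewrite Hin -/(undup (y :: f)).
case: p Hp => [|p] Hp; last first.
  have -> : ascents [:: x, y & f] p.+1 = (x < y) + ascents (y :: f) p.
    by rewrite /ascents -[p.+1]add1n iotaD count_cat /= addn0 (iotaDl 1 0) count_map.
  rewrite [LHS]/= IHf //; case: eqP => [->|/eqP Hne]; first by rewrite ltnn.
  by have -> : x < y = true by rewrite ltn_neqAle Hne Hxy.
by case: eqP => [->|_] //=; have := IHf 0 Hf isT.
Qed.

Variable f : seq nat.
Hypotheses (f_ne : 0 < size f) (f_nak : nakayama f).

Local Notation n := (size f).
Local Notation V := (values f).

Lemma nakayama_last : nth 0 f n.-1 = n.
Proof.
have Hn : n.-1 < n by move: f_ne; lia.
by have := nakayama_bounds f_nak Hn; lia.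
Qed.

Lemma mem_nakayama x : x \in f -> 0 < x <= n.
Proof.
move=> /(nthP 0) [i Hi <-]; have /andP [H1 H2] := nakayama_bounds f_nak Hi.
by apply/andP; split; [exact: leq_ltn_trans H1 | exact: H2].
Qed.

Lemma mem_values x : (x \in V) = (x \in f).
Proof.
rewrite mem_filter mem_iota /=; case E: (x \in f) => //=.
by have := mem_nakayama E; lia.
Qed.

Lemma values_sorted : sorted ltn V.
Proof. by apply: sorted_filter (iota_ltn_sorted _ _); apply: ltn_trans. Qed.

Lemma nth_values p : p < n -> nth 0 f p = nth 0 V (ascents f p).
Proof.
move=> Hp; rewrite undup_asc //; last exact: nakayama_sorted.
congr nth; apply: (irr_sorted_eq ltn_trans ltnn _ values_sorted).
  by rewrite ltn_sorted_uniq_leq undup_uniq undup_sorted ?nakayama_sorted //;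
    apply: leq_trans.
by move=> x; rewrite mem_undup mem_values.
Qed.

Lemma ascents_lt p : p < n -> ascents f p < size V.
Proof.
move=> Hp; rewrite ltnNge; apply/negP => H.
(* Beyond the end of the list [nth] would return 0, contradicting f(p) > p. *)
by have := nakayama_bounds f_nak Hp; rewrite nth_values // nth_default //; lia.
Qed.

Lemma values_lt i j : i < j < size V -> nth 0 V i < nth 0 V j.
Proof.
move=> /andP [Hij Hj]; apply: (sorted_ltn_nth ltn_trans 0 values_sorted) => //.
by rewrite inE; apply: ltn_trans Hij Hj.
Qed.

Lemma values_inj i j : i < size V -> j < size V -> nth 0 V i = nth 0 V j -> i = j.
Proof.
move=> Hi Hj E; have := @values_lt i j; have := @values_lt j i; lia.
Qed.

(** The values that are vertices; the value [n] only marks the end of the quiver. *)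
Local Notation V' := [seq i.+1 | i <- iota 0 n.-1 & i.+1 \in f].

Lemma valuesE : V = rcons V' n.
Proof.
have Ei : iota 1 n = rcons (iota 1 n.-1) n.
  by rewrite -{1}(prednK f_ne) -[n.-1.+1]addn1 iotaD add1n prednK // cats1.
have Hn : n \in f by rewrite -{1}nakayama_last mem_nth // prednK.
by rewrite /values Ei filter_rcons /= Hn (iotaDl 1 0) filter_map.
Qed.

Lemma size_values : size V = (size V').+1.
Proof. by rewrite valuesE size_rcons. Qed.

Lemma ascents_last : ascents f n.-1 = size V'.
Proof.
apply: values_inj; rewrite ?size_values //.
  by rewrite -size_values; apply: ascents_lt; rewrite prednK.
rewrite -nth_values ?prednK // nakayama_last valuesE nth_rcons ltnn eqxx //.
Qed.

Lemma epsE : eps f = [seq ascents f x | x <- V'].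
Proof.
rewrite /eps /letters -[0]/(count (ascent f) (iota 0 0)).
by rewrite (ups_before_flat (ascent f) (fun i => i.+1 \in f)) -map_comp.
Qed.

Lemma size_eps : size (eps f) = size V'.
Proof. by rewrite epsE size_map. Qed.

Lemma nth_V i : i < size V' -> nth 0 V i = nth 0 V' i.
Proof. by move=> Hi; rewrite valuesE nth_rcons Hi. Qed.

Lemma values_lt_n i : i < size V' -> 0 < nth 0 V i < n.
Proof.
move=> Hi; rewrite nth_V //; have /mapP [x] := mem_nth 0 Hi.
by rewrite mem_filter mem_iota => H ->; move: H; lia.
Qed.

Lemma nth_eps i : i < size V' -> nth 0 (eps f) i = ascents f (nth 0 V i).
Proof. by move=> Hi; rewrite epsE (nth_map 0) // nth_V. Qed.

(** The increasing enumeration of the values intertwines [eps f] with [f], as [pd_leb_transfer]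
    requires. *)
Lemma f_values i : i < size V' ->
  nth 0 f (nth 0 V i) = nth 0 V (nth 0 (eps f) i).
Proof. by move=> Hi; rewrite nth_eps // nth_values //; have := values_lt_n Hi; lia. Qed.

Lemma nakayama_eps : nakayama (eps f).
Proof.
split=> [|i]; rewrite ?size_eps.
  exact: path_sorted (ups_before_path 0 _).
move=> Hi; have Hv := values_lt_n Hi.
have Hlt : ascents f (nth 0 V i) < size V by apply: ascents_lt; lia.
rewrite nth_eps //; rewrite size_values in Hlt; apply/andP; split=> //.
rewrite ltnNge; apply/negP => H.
have := nakayama_bounds f_nak (i := nth 0 V i); rewrite f_values // nth_eps //.
have := @values_lt (ascents f (nth 0 V i)) i; rewrite size_values.
case: (eqVneq (ascents f (nth 0 V i)) i) => [->|]; first by lia.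
by lia.
Qed.

Hypothesis f_conn : connected f.

(** By connectedness f(i), the value of index [ascents f i], exceeds i + 1; so at most [ascents f i]
    values are at most i + 1. *)
Lemma balanced_letters : balanced 0 (letters f).
Proof.
apply: (@balanced_iota (ascent f) (fun i => i.+1 \in f) 0 n.-1) => [i Hi|]; last first.
  by rewrite -/(ascents f _) ascents_last size_map size_filter.
rewrite add0n in Hi.
have Hfi := f_conn (i := i); rewrite leqNgt; apply/negP => H.
have Hin : i < n by lia.
have := nth_values Hin; set a := ascents f i => E.
have EV : V = [seq j.+1 | j <- iota 0 i.+1 & j.+1 \in f] ++
            filter (mem f) (iota i.+2 (n - i.+1)).
  rewrite /values -{1}(subnKC Hin) iotaD filter_cat; congr (_ ++ _).
  by rewrite (iotaDl 1 0) filter_map.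
have Ha : a < size [seq j.+1 | j <- iota 0 i.+1 & j.+1 \in f].
  by rewrite size_map size_filter.
move: E; rewrite EV nth_cat Ha => E.
have /mapP [x] := mem_nth 0 Ha; rewrite mem_filter mem_iota -E => H1 H2.
by move: Hi H1 Hfi; rewrite H2; lia.
Qed.

Lemma gld_leb0 : gld_leb f 0 = (n == 1).
Proof.
apply/gld_lebP/eqP => [H | Hn i Hi].
  have := H 0 f_ne; rewrite /= orbF => /eqP H0.
  by have := f_conn (i := 0); rewrite -H0; lia.
have -> : i = n.-1 by lia.
by rewrite /= nakayama_last prednK // eqxx.
Qed.

(** Without an ascent f(i) = f(i+1), so the first syzygy [i+1, f(i)) is projective; the last simple
    is itself projective. *)
Lemma pd_leb_descent k i : i < n -> ~~ ((i.+1 < n) && ascent f i) ->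
  pd_leb (nth 0 f) k.+1 i i.+1.
Proof.
move=> Hi; have [Hi'|Hi'] /= := ltnP i.+1 n.
  rewrite /ascent -leqNgt => H; have := nakayama_mono f_nak (i := i) (j := i.+1).
  move=> H'; have -> : nth 0 f i = nth 0 f i.+1 by lia.
  by case: k => [|k] /=; rewrite eqxx orbT.
have -> : i = n.-1 by lia.
by move=> _; rewrite nakayama_last prednK // eqxx.
Qed.

(** The second syzygy is [f(i), f(i+1)), whose ends are consecutive values: a simple for [eps f]. *)
Lemma pd_leb_ascent k i : i.+1 < n -> ascent f i ->
  pd_leb (nth 0 f) k.+1 i i.+1 =
  if k is k'.+1 then pd_leb (nth 0 (eps f)) k' (ascents f i) (ascents f i).+1 else false.
Proof.
move=> Hi Ha; have Hfi := f_conn Hi; rewrite /ascent in Ha.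
rewrite /=; have -> : (i.+1 == nth 0 f i) = false by lia.
case: k => [|k] /=; have -> : (nth 0 f i == nth 0 f i.+1) = false by lia.
  by [].
rewrite /= nth_values ?(ltnW Hi) // nth_values //.
have ES : ascents f i.+1 = (ascents f i).+1 by rewrite /ascents count_iotaS /ascent
  Ha addn1.
rewrite ES; have Hlt := ascents_lt Hi; rewrite ES size_values in Hlt.
have [_ Hb] := nakayama_eps; rewrite size_eps in Hb.
apply: (@pd_leb_transfer _ _ _ (size V')) => //.
- by move=> a b Hab; apply: (nakayama_mono nakayama_eps); rewrite size_eps.
- by move=> a b Ha' Hb'; apply: values_inj; rewrite size_values ltnS.
- exact: f_values.
- by have := Hb (ascents f i); lia.
Qed.

Lemma gld_leb1 : gld_leb f 1 = nilp (eps f).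
Proof.
apply/gld_lebP/idP => [H | /nilP He i Hi].
  rewrite /nilp size_eps -ascents_last; case E: (ascents f n.-1) => [|m] //.
  have [|i [Hi Ha _]] := @count_iota_lt (ascent f) n.-1 0;
    first by rewrite -/(ascents _ _) E.
  by have := H i; rewrite pd_leb_ascent //; lia.
apply: pd_leb_descent => //; apply/andP => -[Hi' Ha].
have := ascents_lt Hi'; rewrite size_values -size_eps He /ascents count_iotaS Ha /=; lia.
Qed.

Lemma gld_leb_eps k : gld_leb f k.+2 = gld_leb (eps f) k.
Proof.
apply/gld_lebP/gld_lebP => H i Hi.
  (* Every simple for [eps f] arises, namely from the ascent [j] preceded by exactly [i] others. *)
  rewrite size_eps -ascents_last in Hi; have [j [Hj Ha E]] := count_iota_lt Hi.
  have := H j; rewrite pd_leb_ascent //; last by lia.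
  by rewrite /ascents E; apply; lia.
have [/andP [Hi' Ha]|Hn] := boolP ((i.+1 < n) && ascent f i); last exact: pd_leb_descent.
rewrite pd_leb_ascent //; apply: H; have := ascents_lt Hi'.
by rewrite size_eps size_values /ascents count_iotaS Ha; lia.
Qed.

Lemma size_flat_letters : size (flat (letters f)) = (ascents f n.-1).*2.
Proof.
have := size_eps; rewrite /eps size_ups_before ascents_last.
have := dyck_count (dyck_flat balanced_letters); rewrite size_count; lia.
Qed.

End Nakayama.

(** The letters record the ascents and the values, and f(p) is the value of index [ascents f p]. *)
Lemma letters_inj f g :
  0 < size f -> nakayama f -> 0 < size g -> nakayama g -> letters f = letters g -> f = g.
Proof.
move=> Hf0 Hf Hg0 Hg E.
have Es : size f = size g.
  by have := congr1 size E; rewrite !size_map !size_iota; lia.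
have EA : {in iota 0 (size f).-1, forall i, ascent f i = ascent g i /\ (i.+1 \in f) =
  (i.+1 \in g)}.
  move: E; rewrite /letters -Es => /eq_in_map H i Hi.
  by have [] := H i Hi.
have EN p : p < size f -> ascents f p = ascents g p.
  move=> Hp; apply: eq_in_count => i Hi.
  by have [|->] := EA i _; move: Hi; rewrite ?mem_iota //; lia.
have EV : values f = values g.
  rewrite valuesE // valuesE // -Es; congr rcons; congr map.
  by apply: eq_in_filter => i /EA [].
apply: (@eq_from_nth _ 0) => // i Hi.
by rewrite (nth_values Hf0 Hf Hi) (nth_values Hg0 Hg) -?Es // EN // EV.
Qed.

(** * Dyck words as Kupisch series, and their peaks *)

Lemma dyck_size s : dyck_from 0 s -> size s = (count negb s).*2.
Proof. by move=> H; rewrite size_count (dyck_count H); lia. Qed.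

Lemma ups_before_nakayama s : dyck_from 0 s -> nakayama (ups_before 0 s).
Proof.
move=> H; split; first exact: path_sorted (ups_before_path 0 s).
move=> i Hi; have := ups_before_ge H Hi; have := ups_before_le Hi.
rewrite size_ups_before (dyck_count H); lia.
Qed.

Definition kupisch_of r := ups_before 0 (true :: rcons r false).

Lemma dyck_prime r : dyck_from 0 r -> dyck_from 0 (true :: rcons r false).
Proof. by move=> H; rewrite -cats1 /= (dyck_cat (k := 0) 1 _ H). Qed.

Lemma kupisch_of_nakayama r : dyck_from 0 r -> nakayama (kupisch_of r).
Proof. by move=> /dyck_prime /ups_before_nakayama. Qed.

Lemma size_kupisch_of r : dyck_from 0 r -> size (kupisch_of r) = (size r)./2.+1.
Proof.
move=> H; rewrite size_ups_before /= -cats1 count_cat /= (dyck_size H) doubleK; lia.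
Qed.

Lemma kupisch_of_connected r : dyck_from 0 r -> connected (kupisch_of r).
Proof.
move=> H i; rewrite /kupisch_of /= -cats1 ups_before_cat size_cat nth_cat /= addn1 => Hi.
rewrite ltnS in Hi; rewrite Hi.
by have := ups_before_ge H Hi; lia.
Qed.

Lemma kupisch_of_inj : injective kupisch_of.
Proof.
move=> r s /(congr1 (word_from 0));
  rewrite /kupisch_of -!rcons_cons !word_from_ups_before //=.
by move=> [] /rcons_inj [].
Qed.

Lemma ascents_cons x f p : ascents (x :: f) p.+1 = (x < nth 0 f 0) + ascents f p.
Proof. by rewrite /ascents -[p.+1]add1n iotaD count_cat /= addn0 (iotaDl 1 0)
  count_map. Qed.

(** A down step closes a peak exactly when the number of up steps has grown since the previous down
    step, where it was [p]. *)
Lemma peaks_ups_before p acc s : p <= acc ->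
  peaks (p < acc) s = ascents (p :: ups_before acc s) (size (ups_before acc s)).
Proof.
elim: s p acc => [|[] s IHs] p acc Hp //=.
  by rewrite andbF add0n -IHs ?(leqW Hp) // ltnS Hp.
by rewrite andbT ascents_cons /= -IHs // ltnn.
Qed.

Lemma peaks_cat up s t : peaks up (s ++ t) = peaks up s + peaks (last up s) t.
Proof. by elim: s up => //= x s IHs up; rewrite IHs addnA. Qed.

Lemma peaks_up s : dyck_from 0 s -> peaks true s = peaks false s.
Proof. by case: s => [|[]]. Qed.

Lemma peaks_prime r s : dyck_from 0 r ->
  peaks false (true :: r ++ false :: s) = peaks false r + nilp r + peaks false s.
Proof. by move=> H;
  rewrite /= peaks_cat (dyck_last _ H) /= peaks_up // andbT add0n addnA. Qed.

(** In a factor lifted off the ground every peak has positive height. *)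
Lemma high_peaks_cat k h up s t : dyck_from k s ->
  high_peaks (k + h.+1) up (s ++ t) = peaks up s + high_peaks h.+1 (last up s) t.
Proof.
elim: s k up => [|[] s IHs] k up /=; first by move=> /eqP ->.
  by rewrite andbF => H; rewrite -(IHs k.+1) //; congr high_peaks; lia.
by case: k => // k H; rewrite andbT -addnA -(IHs k).
Qed.

Lemma high_peaks_prime r s : dyck_from 0 r ->
  high_peaks 0 false (true :: r ++ false :: s) = peaks false r + high_peaks 0 false s.
Proof. by move=> H; rewrite /= (@high_peaks_cat 0 0) //= (dyck_last _ H). Qed.

Lemma peaks_kupisch_of r : dyck_from 0 r ->
  peaks false r + nilp r = (ascents (kupisch_of r) (size r)./2).+1.
Proof.
(* A fictitious value 0 precedes the list; as f(0) > 0, it accounts for the extra one. *)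
move=> H; have := @peaks_ups_before 0 0 (true :: rcons r false) isT.
rewrite -/(kupisch_of r) size_kupisch_of // ascents_cons ltnn.
have := peaks_prime [::] H; rewrite cats1 => -> /=; rewrite addn0 => ->.
have := nakayama_bounds (kupisch_of_nakayama H) (i := 0);
  rewrite size_kupisch_of // => /(_ isT).
by case/andP=> ->.
Qed.

Lemma height_from0 s : dyck_from 0 s -> (height_from 0 s <= 0) = nilp s.
Proof.
case/dyckP => // r t Hr _; by rewrite height_prime // geq_max.
Qed.

(** Shifted concatenation is the product of two algebras, and no syzygy crosses the border; prime
    factors of a Dyck word correspond to such blocks. *)
Lemma gld_leb_cat f g k : nakayama f -> nakayama g ->
  gld_leb (f ++ [seq size f + x | x <- g]) k = gld_leb f k && gld_leb g k.
Proof.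
move=> Hf Hg; set F := f ++ _.
have Hl i : i < size f -> pd_leb (nth 0 F) k i i.+1 = pd_leb (nth 0 f) k i i.+1.
  move=> Hi; apply: (@pd_leb_transfer _ _ id (size f)) => //.
  - exact: nakayama_bounds.
  - by move=> *; apply: nakayama_mono.
  - by move=> j Hj; rewrite /F nth_cat Hj.
  - by have := nakayama_bounds Hf Hi; lia.
have Hr i : i < size g ->
    pd_leb (nth 0 F) k (size f + i) (size f + i).+1 = pd_leb (nth 0 g) k i i.+1.
  move=> Hi; rewrite -addnS; apply: (@pd_leb_transfer _ _ (addn (size f)) (size g)) => //.
  - exact: nakayama_bounds.
  - by move=> *; apply: nakayama_mono.
  - by move=> *; lia.
  - move=> j Hj; rewrite /F nth_cat ltnNge leq_addr /= addKn (nth_map 0) //.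
  - by have := nakayama_bounds Hg Hi; lia.
have sF : size F = size f + size g by rewrite size_cat size_map.
apply/gld_lebP/andP => [H | [/gld_lebP H1 /gld_lebP H2] i].
  split; apply/gld_lebP => i Hi; first by rewrite -Hl //; apply: H; rewrite sF; lia.
  by rewrite -Hr //; apply: H; rewrite sF; lia.
rewrite sF => Hi; have [Hi'|Hi'] := ltnP i (size f); first by rewrite Hl //; apply: H1.
by rewrite -(subnKC Hi') Hr; [apply: H2|]; lia.
Qed.

(** * The bijection *)

(** The step for a connected algebra: the interior [r] is split into a word no longer than [r] and
    gap data, which are reinserted as peaks into the image of that word. *)
Definition theta1 (Psi : seq bool -> seq bool) r :=
  let a := letters (kupisch_of r) in build false (Psi (flat a)) (gaps 0 false 0 a).

(* [k] only bounds the recursion depth; the size of [s] suffices. *)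
Fixpoint theta k s :=
  if k is k'.+1 then
    if s is _ :: t then
      let i := first_return 0 t in
      true :: theta1 (theta k') (take i t) ++ false :: theta k' (drop i.+1 t)
    else [::]
  else [::].

(* In [good_pk], 2 (peaks + high peaks) = size is what makes the gap data on both
   sides range over the same set. *)
Record good N (Psi : seq bool -> seq bool) : Prop := Good {
  good_dy : forall s, dyck_from 0 s -> size s <= N -> dyck_from 0 (Psi s);
  good_size : forall s, dyck_from 0 s -> size s <= N -> size (Psi s) = size s;
  good_pk : forall s, dyck_from 0 s -> size s <= N ->
    (peaks false (Psi s) + high_peaks 0 false s).*2 = size s;
  good_ht : forall s k, dyck_from 0 s -> size s <= N ->
    (height_from 0 (Psi s) <= k.+1) = gld_leb (ups_before 0 s) k;
  good_inj : forall s t, dyck_from 0 s -> dyck_from 0 t -> size s <= N -> size t <= N ->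
    Psi s = Psi t -> s = t }.

Section Step.

Variables (N : nat) (Psi : seq bool -> seq bool).
Hypothesis HPsi : good N Psi.

Let a r := letters (kupisch_of r).

Lemma kupisch_of_flat r : dyck_from 0 r ->
  dyck_from 0 (flat (a r)) /\ size (flat (a r)) = (ascents (kupisch_of r) (size r)./2).*2.
Proof.
move=> H; have Hk : 0 < size (kupisch_of r) by rewrite size_kupisch_of.
split; first exact: dyck_flat (balanced_letters Hk (kupisch_of_nakayama H)
  (kupisch_of_connected H)).
by rewrite size_flat_letters ?size_kupisch_of //;
  [exact: kupisch_of_nakayama | exact: kupisch_of_connected].
Qed.

Lemma balanced_kupisch_of r : dyck_from 0 r -> balanced 0 (a r).
Proof.
move=> H; apply: balanced_letters;
  [by rewrite size_kupisch_of | exact: kupisch_of_nakayama | exact: kupisch_of_connected].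
Qed.

Lemma size_flat_le r : dyck_from 0 r -> size (flat (a r)) <= size r.
Proof.
move=> H; have [_ ->] := kupisch_of_flat H.
have : ascents (kupisch_of r) (size r)./2 <= (size r)./2.
  by have := count_size (ascent (kupisch_of r)) (iota 0 (size r)./2); rewrite size_iota.
by rewrite (dyck_size H); lia.
Qed.

Lemma theta1_dyck r : dyck_from 0 r -> size r <= N -> dyck_from 0 (theta1 Psi r).
Proof.
move=> H HN; rewrite dyck_build; apply: (good_dy HPsi);
  first by case: (kupisch_of_flat H).
exact: leq_trans (size_flat_le H) HN.
Qed.

Lemma size_gaps_Psi r : dyck_from 0 r -> size r <= N ->
  size (gaps 0 false 0 (a r)) = (size (Psi (flat (a r)))).+1.
Proof.
move=> H HN; rewrite size_gaps (good_size HPsi) //; first by case: (kupisch_of_flat H).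
exact: leq_trans (size_flat_le H) HN.
Qed.

(** With s = [flat (a r)], the gaps add up to half the length of r, minus the length of s, plus the
    high peaks of s. By [good_pk] these and the peaks of [Psi s] make half the length of s, and the
    terms in s cancel. *)
Lemma theta1_size r : dyck_from 0 r -> size r <= N -> size (theta1 Psi r) = size r.
Proof.
move=> H HN; rewrite size_build; last exact: size_gaps_Psi.
have [Hd _] := kupisch_of_flat H; have HN' := leq_trans (size_flat_le H) HN.
have := good_pk HPsi Hd HN'; have := good_size HPsi Hd HN'.
have := sumn_gaps false 0 (balanced_kupisch_of H).
rewrite /a size_map size_iota size_kupisch_of //= (dyck_size H); lia.
Qed.

Lemma theta1_peaks r : dyck_from 0 r -> size r <= N ->
  (peaks false (theta1 Psi r)).*2 + size (flat (a r)) = size r.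
Proof.
move=> H HN; have := theta1_size H HN; rewrite size_build ?peaks_build;
  try exact: size_gaps_Psi.
have [Hd _] := kupisch_of_flat H; have HN' := leq_trans (size_flat_le H) HN.
by rewrite (good_size HPsi Hd HN') -/(a r); lia.
Qed.

(** Inserting peaks adds one and [good_ht] is shifted by one more, matching the drop by two in
    [gld_leb_eps]; the bounds 0 and 1 are treated apart. *)
Lemma theta1_height r k : dyck_from 0 r -> size r <= N ->
  (height_from 0 (theta1 Psi r) <= k) = gld_leb (kupisch_of r) k.
Proof.
move=> H HN; have [Hd _] := kupisch_of_flat H; have HN' := leq_trans (size_flat_le H) HN.
have Hk : 0 < size (kupisch_of r) by rewrite size_kupisch_of.
have HPd := good_dy HPsi Hd HN'; have HPs := good_size HPsi Hd HN'.
case: k => [|[|k]].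
- rewrite height_from0 ?theta1_dyck // gld_leb0 ?size_kupisch_of //;
  try exact: kupisch_of_nakayama; try exact: kupisch_of_connected.
  by rewrite /nilp theta1_size // (dyck_size H) doubleK; lia.
- rewrite height_build_leq ?size_gaps_Psi // height_from0 // gld_leb1 //;
  try exact: kupisch_of_nakayama; try exact: kupisch_of_connected.
  by rewrite /nilp HPs /eps size_ups_before -/(a r) (dyck_size Hd); lia.
- rewrite height_build_leq ?size_gaps_Psi // (good_ht HPsi) // gld_leb_eps //;
  try exact: kupisch_of_nakayama; exact: kupisch_of_connected.
Qed.

Lemma theta1_inj r s : dyck_from 0 r -> dyck_from 0 s -> size r <= N -> size s <= N ->
  theta1 Psi r = theta1 Psi s -> r = s.
Proof.
move=> Hr Hs HrN HsN /(congr1 (unbuild false 0)).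
rewrite !buildK ?size_gaps_Psi // !add0n.
have E x : dyck_from 0 x -> size x <= N ->
   head 0 (gaps 0 false 0 (a x)) :: behead (gaps 0 false 0 (a x)) = gaps 0 false 0 (a x).
  by move=> Hx HxN; have := size_gaps_Psi Hx HxN; case: (gaps _ _ _ _).
rewrite !E // => -[EP Eg].
have [Hrd _] := kupisch_of_flat Hr; have [Hsd _] := kupisch_of_flat Hs.
have Ef : flat (a r) = flat (a s).
  apply: (good_inj HPsi) EP => //; [exact: leq_trans (size_flat_le Hr) HrN |
    exact: leq_trans (size_flat_le Hs) HsN].
have := gapsK false 0 (balanced_kupisch_of Hr);
  rewrite Ef Eg (gapsK false 0 (balanced_kupisch_of Hs)) /=.
move=> /esym /letters_inj Ek; apply: kupisch_of_inj; apply: Ek;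
  rewrite ?size_kupisch_of //; exact: kupisch_of_nakayama.
Qed.

End Step.

Lemma theta_prime k r s : dyck_from 0 r ->
  theta k.+1 (true :: r ++ false :: s) = true :: theta1 (theta k) r ++ false :: theta k s.
Proof.
move=> H /=; rewrite fr_cat // take_size_cat // drop_cat ltnNge leqnSn /=.
by rewrite subSnn /= drop0.
Qed.

Lemma ups_before_prime r s : dyck_from 0 r ->
  ups_before 0 (true :: r ++ false :: s) =
  kupisch_of r ++ [seq size (kupisch_of r) + x | x <- ups_before 0 s].
Proof.
move=> H; rewrite -ups_before_shift addn0 -cat_rcons -cat_cons ups_before_cat;
  congr (_ ++ ups_before _ _).
rewrite size_ups_before; have := dyck_count (dyck_prime H); lia.
Qed.

Lemma size_prime (r s : seq bool) : size (true :: r ++ false :: s) = (size r + size s).+2.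
Proof. by rewrite /= size_cat /= addnS. Qed.

Lemma theta_good k : good k (theta k).
Proof.
elim: k => [|k IHk].
  have E (s : seq bool) : size s <= 0 -> s = [::] by rewrite leqn0 size_eq0 => /eqP.
  by split=> //= [s _ /E ->|s _ /E ->|s k _ /E ->|s t _ _ /E -> /E ->].
split.
- move=> s /dyckP [] // r t Hr Ht; rewrite size_prime theta_prime // => Hs.
  have Hd : dyck_from 0 (theta1 (theta k) r) by apply: (theta1_dyck IHk) => //; lia.
  by rewrite /= (dyck_cat (k := 0) 1 _ Hd) /=; apply: (good_dy IHk) => //; lia.
- move=> s /dyckP [] // r t Hr Ht; rewrite size_prime theta_prime // => Hs.
  by rewrite size_prime (theta1_size IHk) ?(good_size IHk) //; lia.
- move=> s /dyckP [] // r t Hr Ht; rewrite size_prime theta_prime // => Hs.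
  have Hd : dyck_from 0 (theta1 (theta k) r) by apply: (theta1_dyck IHk) => //; lia.
  (* The number of ascents cancels: it lowers the peaks of the image by [theta1_peaks] and raises
     those of [r] by [peaks_kupisch_of]. *)
  rewrite peaks_prime // high_peaks_prime //.
  have := good_pk IHk Ht ltac:(lia); have := theta1_peaks IHk Hr ltac:(lia).
  have [_ ->] := kupisch_of_flat Hr; have := peaks_kupisch_of Hr.
  by rewrite /nilp (theta1_size IHk) //; lia.
- move=> s g /dyckP [] // r t Hr Ht; rewrite size_prime theta_prime // => Hs.
  have Hd : dyck_from 0 (theta1 (theta k) r) by apply: (theta1_dyck IHk) => //; lia.
  rewrite height_prime // geq_max ltnS (theta1_height IHk) //; last by lia.
  rewrite (good_ht IHk) //; last by lia.
  by rewrite ups_before_prime // gld_leb_cat //; try exact: kupisch_of_nakayama;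
    exact: ups_before_nakayama.
- move=> s t /dyckP [|r1 s1 Hr1 Hs1] /dyckP [|r2 s2 Hr2 Hs2] //;
    rewrite ?size_prime !theta_prime // => H1 H2 [] E.
  have Hd1 : dyck_from 0 (theta1 (theta k) r1) by apply: (theta1_dyck IHk) => //; lia.
  have Hd2 : dyck_from 0 (theta1 (theta k) r2) by apply: (theta1_dyck IHk) => //; lia.
  (* Equal images have the same first return, hence the same interiors and tails. *)
  have Es : size (theta1 (theta k) r1) = size (theta1 (theta k) r2).
    by rewrite -(fr_cat (theta k s1) Hd1) E fr_cat.
  move/eqP: E; rewrite eqseq_cat // => /andP [/eqP E1 /eqP [E2]].
  rewrite (theta1_inj IHk _ _ _ _ E1) //; try lia.
  by rewrite (good_inj IHk _ _ _ _ E2) //; lia.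
Qed.

(** * From Kupisch series back to Dyck words *)

Lemma ups_before_nseq acc k s :
  ups_before acc (nseq k true ++ s) = ups_before (acc + k) s.
Proof. by elim: k acc => [|k IHk] acc /=; rewrite ?addn0 // IHk addSnnS. Qed.

Lemma ups_before_word_from acc f : path leq acc f -> ups_before acc (word_from acc f) = f.
Proof.
elim: f acc => //= x f IHf acc /andP [Hx Hf].
by rewrite ups_before_nseq subnKC //= IHf.
Qed.

Lemma dyck_nseq h k s : dyck_from h (nseq k true ++ s) = dyck_from (h + k) s.
Proof. by elim: k h => [|k IHk] h /=; rewrite ?addn0 // IHk addSnnS. Qed.

(** Here [acc] and [d] are the numbers of up and down steps already read. *)
Lemma dyck_word_from acc d f : path leq acc f -> d <= acc ->
  (forall i, i < size f -> i + d < nth 0 f i) -> last acc f = d + size f ->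
  dyck_from (acc - d) (word_from acc f).
Proof.
elim: f acc d => [|x f IHf] acc d /=; first by move=> _ _ _ ->; lia.
move=> /andP [Hx Hf] Hd H Hl; rewrite dyck_nseq /=; have := H 0 isT => /= H0.
apply/andP; split; first by lia.
have -> : (acc - d + (x - acc)).-1 = x - d.+1 by lia.
by apply: IHf => // [i Hi|]; [have := H i.+1 Hi; rewrite /= addnS | rewrite Hl; lia].
Qed.

(** Inverse of [kupisch_of]: starting at 1 omits the outer up step, and leaving out the last entry
    omits the outer down step. *)
Definition dyck_of f := word_from 1 (take (size f).-1 f).

Lemma dyck_ofP f : 0 < size f -> nakayama f -> connected f ->
  dyck_from 0 (dyck_of f) /\ kupisch_of (dyck_of f) = f.
Proof.
move=> H0 Hf Hc; rewrite /dyck_of; have := nakayama_last H0 Hf.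
case/lastP: f H0 Hf Hc => // f x _ Hf Hc.
rewrite size_rcons /= -cats1 take_size_cat // cats1 nth_rcons ltnn eqxx => Ex.
have Hpath : path leq 1 f.
  have [Hs Hb] := Hf; have /= := Hb 0; rewrite size_rcons => /(_ isT).
  move: Hs; rewrite /= -cats1; case: f {Hf Hc Ex Hb} => //= y f.
  by rewrite cat_path => /andP [-> _]; lia.
have Hn i : i < size f -> i.+1 < nth 0 f i.
  by move=> Hi; have := Hc i; rewrite size_rcons nth_rcons Hi ltnS; apply.
have Hdy : dyck_from 0 (word_from 1 f).
  apply: (@dyck_word_from 1 1) => // [i Hi|]; first by rewrite addn1; apply: Hn.
  case/lastP: f Hf Ex Hn {Hpath Hc} => // f y Hf Ex Hn.
  have := nakayama_bounds Hf (i := size f);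
    rewrite !nth_rcons !size_rcons ltnS leqnn ltnn eqxx.
  have := Hn (size f); rewrite nth_rcons size_rcons ltnn eqxx last_rcons; lia.
split=> //; rewrite /kupisch_of /= -cats1 ups_before_cat ups_before_word_from //=
  cats1; congr rcons.
have := dyck_count Hdy; rewrite -(size_ups_before 1) ups_before_word_from // Ex; lia.
Qed.

(** * Agreement with the Dyck paths of the statement *)

Lemma dyck_fromP h s : reflect
  ((forall k, downs (take k s) <= h + ups (take k s)) /\ h + ups s = downs s)
    (dyck_from h s).
Proof.
rewrite /downs /ups; elim: s h => [|x s IHs] h /=.
  by apply: (iffP eqP) => [->|[_]]; [split | lia].
case: x => /=.
  apply: (iffP (IHs _)) => -[H1 H2].
    by split=> [[|k] //=|]; [have := H1 k|]; lia.
  by split=> [k|]; [have := H1 k.+1; rewrite /=|]; lia.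
apply: (iffP andP) => [[Hh /IHs [H1 H2]]|[H1 H2]].
  by split=> [[|k] //=|]; [have := H1 k|]; lia.
have H := H1 1; rewrite /= take0 /= in H.
split; first by lia.
by apply/IHs; split=> [k|]; [have := H1 k.+1; rewrite /=|]; lia.
Qed.

Lemma dyckE m (D : (2 * m).-tuple bool) : dyck D = dyck_from 0 D.
Proof.
apply/andP/dyck_fromP => [[/forallP H /eqP E] | [H E]]; split=> //.
- move=> k; have [Hk|Hk] := ltnP k (2 * m).+1; first exact: (H (Ordinal Hk)).
  have := H ord_max; rewrite !take_oversize ?size_tuple //; exact: ltnW.
- by apply/forallP => k; apply: H.
- by rewrite -E.
Qed.

Lemma height_fromE h s : dyck_from h s ->
  height_from h s = \max_(k < (size s).+1) (h + ups (take k s) - downs (take k s)).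
Proof.
elim: s h => [|x s IHs] h Hs.
  by rewrite big_ord_recl big_ord0 /= addn0 subn0 maxn0.
rewrite big_ord_recl /= addn0 subn0; congr maxn.
case: x Hs => /= [|/andP [Hh]] /IHs ->; apply: eq_bigr => k _;
  rewrite /bump /= /ups /downs /= add0n; move: (count id _) (count negb _); lia.
Qed.

Lemma heightE m (D : (2 * m).-tuple bool) : dyck D -> height D = height_from 0 D.
Proof. by rewrite dyckE => /height_fromE ->; rewrite size_tuple. Qed.

(** * Kupisch series and their lists of values *)

Section Kupisch.
Variable n : nat.
Implicit Types c : n.-tuple 'I_n.+1.

Definition klist c := [seq i + kval c i | i <- iota 0 n].

Lemma size_klist c : size (klist c) = n.
Proof. by rewrite size_map size_iota. Qed.

Lemma nth_klist c i : i < n -> nth 0 (klist c) i = i + kval c i.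
Proof. by move=> Hi; rewrite (nth_map 0) ?size_iota // nth_iota. Qed.

Lemma kvalE c (i : 'I_n) : kval c i = tnth c i.
Proof. by rewrite /kval (nth_map ord0) ?size_tuple // (tnth_nth ord0). Qed.

Lemma klist_inj : injective klist.
Proof.
move=> c d E; apply: eq_from_tnth => i; apply: val_inj; rewrite /= -!kvalE.
by have := congr1 (fun s => nth 0 s i) E; rewrite !nth_klist //; lia.
Qed.

Hypothesis n_gt0 : 0 < n.

(** The upper bound on c_i is monotonicity of f, the lower bound 2 is connectedness, and c_(n-1) = 1
    is forced by f(n-1) = n. *)
Lemma kupischP c : reflect (nakayama (klist c) /\ connected (klist c)) (kupisch c).
Proof.
apply: (iffP andP) => [[/forallP H /eqP Hl] | [Hk Hc]].
  have Hn i : i.+1 < n -> 2 <= kval c i <= (kval c i.+1).+1.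
    by move=> Hi; have /implyP /(_ Hi) := H (Ordinal (ltnW Hi)).
  have Hm i j : i <= j < n -> i + kval c i <= j + kval c j.
    move=> /andP [Hij Hj]; elim: j Hij Hj => [|j IHj] Hij Hj.
      by have -> : i = 0 by lia.
    have [->//|Hne] := eqVneq i j.+1.
    by have := Hn j Hj; have := IHj; lia.
  have Hpos i : i < n -> 0 < kval c i.
    move=> Hi; have [->|Hne] := eqVneq i n.-1; first by rewrite Hl.
    by have := Hn i; lia.
  split; last by move=> i; rewrite size_klist => Hi; rewrite nth_klist;
    have := Hn i Hi; lia.
  split=> [|i].
    apply/(sortedP 0) => i; rewrite size_klist => Hi.
    by rewrite !nth_klist; [apply: Hm | |]; lia.
  rewrite size_klist => Hi; rewrite nth_klist //; have := Hpos i Hi.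
  by have := Hm i n.-1; rewrite Hl; lia.
have Hlast := nakayama_last _ Hk; rewrite size_klist nth_klist ?prednK // in Hlast.
split; last by apply/eqP; have := Hlast n_gt0; lia.
apply/forallP => i; apply/implyP => Hi.
have := Hc i; have := nakayama_mono Hk (i := i) (j := i.+1).
by rewrite size_klist !nth_klist //; lia.
Qed.

Lemma klist_onto f : size f = n -> nakayama f -> connected f ->
  exists2 c, kupisch c & klist c = f.
Proof.
move=> Hn Hf Hc.
pose c := [tuple (inord (nth 0 f i - i) : 'I_n.+1) | i < n].
have E : klist c = f.
  apply: (@eq_from_nth _ 0) => [|i]; rewrite size_klist // => Hi.
  have Hb := nakayama_bounds Hf (i := i); rewrite Hn in Hb.
  by rewrite nth_klist // (kvalE c (Ordinal Hi)) tnth_mktuple inordK /=;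
    have := Hb Hi; lia.
by exists c => //; apply/kupischP; rewrite E.
Qed.

End Kupisch.

Lemma gldim_klist (K : fieldType) n (c : n.-tuple 'I_n.+1) m : 0 < n -> kupisch c ->
  gldim_le K n (kval c) m <-> gld_leb (klist c) m.
Proof.
move=> Hn /(kupischP Hn) [Hk Hc].
have Hb i : i < n -> i < i + kval c i <= n.
  by move=> Hi; have := nakayama_bounds Hk (i := i); rewrite size_klist nth_klist //;
    apply.
have Hm i j : i <= j < n -> i + kval c i <= j + kval c j.
  by move=> Hij; have := nakayama_mono Hk (i := i) (j := j);
    rewrite size_klist !nth_klist; lia.
have Hp i : i < n -> pd_leb (nth 0 (klist c)) m i i.+1 = pd_leb (fun j => j + kval c
  j) m i i.+1.
  move=> Hi; apply: (@pd_leb_transfer _ _ id n) => //.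
    by move=> j Hj; rewrite nth_klist.
  by have := Hb i Hi; lia.
apply: (iff_trans (gldim_leP K Hb Hm m)); split=> [H|/gld_lebP H i Hi].
  by apply/gld_lebP => i; rewrite size_klist => Hi; rewrite Hp // H.
by rewrite -Hp //; apply: H; rewrite size_klist.
Qed.

Lemma is_gldim_uniq (K : fieldType) n c g h :
  is_gldim K n c g -> is_gldim K n c h -> g = h.
Proof.
move=> [Hg Lg] [Hh Lh]; apply/eqP; rewrite eqn_leq.
by apply/andP; split; [apply: Lg | apply: Lh].
Qed.

(** * The two bijections onto the set of Dyck words *)

Section Counting.
Variable m : nat.

Definition dycks := [seq tval D | D : (2 * m).-tuple bool in [pred D | dyck D]].

Lemma mem_dycks s : (s \in dycks) = (size s == 2 * m) && dyck_from 0 s.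
Proof.
apply/imageP/andP => [[D HD ->] | [Hs Hd]].
  by rewrite size_tuple -dyckE; split.
by exists (Tuple Hs); rewrite // inE dyckE.
Qed.

Lemma uniq_dycks : uniq dycks.
Proof. by rewrite map_inj_uniq ?enum_uniq //; apply: val_inj. Qed.

Definition kupisch_dycks :=
  [seq dyck_of (klist c) | c : m.+1.-tuple 'I_m.+2 in [pred c | kupisch c]].

Lemma perm_kupisch_dycks : perm_eq kupisch_dycks dycks.
Proof.
have HP (c : m.+1.-tuple 'I_m.+2) : kupisch c ->
    dyck_from 0 (dyck_of (klist c)) /\ kupisch_of (dyck_of (klist c)) = klist c.
  by move=> /kupischP [] // Hk Hc; apply: dyck_ofP; rewrite ?size_klist.
apply: uniq_perm; last move=> s; last rewrite mem_dycks.
- rewrite map_inj_in_uniq ?enum_uniq // => c d.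
  rewrite !mem_enum !inE => /HP [_ Hc] /HP [_ Hd] E.
  by apply: klist_inj; rewrite -Hc -Hd E.
- exact: uniq_dycks.
apply/imageP/andP => [[c Hc ->] | [/eqP Hs Hd]].
  have [Hd Hk] := HP c Hc; split=> //.
  have := congr1 size Hk;
    rewrite size_klist size_kupisch_of // (dyck_size Hd) doubleK => -[->].
  by rewrite mul2n.
have [|||c Hc E] := @klist_onto m.+1 isT (kupisch_of s).
- by rewrite size_kupisch_of // Hs mul2n doubleK.
- exact: kupisch_of_nakayama.
- exact: kupisch_of_connected.
exists c => //; apply: kupisch_of_inj.
by have [_ ->] := HP c Hc; rewrite E.
Qed.

Definition theta_dyck := theta1 (theta (2 * m)).

(** An injective map of a finite set into itself is onto. *)
Lemma perm_theta_dyck : perm_eq [seq theta_dyck s | s <- dycks] dycks.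
Proof.
have good := theta_good (2 * m).
have Hu : uniq [seq theta_dyck s | s <- dycks].
  rewrite map_inj_in_uniq ?uniq_dycks // => s t; rewrite !mem_dycks.
  move=> /andP [/eqP Hs Ds] /andP [/eqP Ht Dt].
  by apply: (theta1_inj good) => //; rewrite ?Hs ?Ht.
apply: uniq_perm; rewrite ?uniq_dycks //.
suff Hsub : {subset [seq theta_dyck s | s <- dycks] <= dycks}.
  by have [] := uniq_min_size Hu Hsub; rewrite ?size_map.
move=> _ /mapP [s + ->]; rewrite !mem_dycks => /andP [/eqP Hs Ds].
by rewrite (theta1_size good) ?Hs // eqxx (theta1_dyck good) ?Hs.
Qed.

Lemma is_gldim_theta (K : fieldType) (c : m.+1.-tuple 'I_m.+2) : kupisch c ->
  is_gldim K m.+1 (kval c) (height_from 0 (theta_dyck (dyck_of (klist c)))).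
Proof.
move=> Hc; have : dyck_of (klist c) \in kupisch_dycks by apply/imageP; exists c.
rewrite (perm_mem perm_kupisch_dycks) mem_dycks => /andP [/eqP Hs Hd].
have [Hk Hcn] := kupischP (ltn0Sn m) c Hc.
have [_ E] := dyck_ofP (f := klist c) ltac:(by rewrite size_klist) Hk Hcn.
have H k : gldim_le K m.+1 (kval c) k <-> height_from 0 (theta_dyck (dyck_of (klist
  c))) <= k.
  apply: (iff_trans (gldim_klist K k _ Hc)) => //.
  by rewrite (theta1_height (theta_good _)) ?Hs // E.
by split=> [|k]; [apply/H | move/H].
Qed.

End Counting.

Local Open Scope ring_scope.

Theorem theorem1p1 (K : closedFieldType) (n : nat) (hn : (1 <= n)%N) :
  (forall c : n.-tuple 'I_n.+1, kupisch c -> exists g, is_gldim K n (kval c) g) /\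
  (forall gd : n.-tuple 'I_n.+1 -> nat,
     (forall c, kupisch c -> is_gldim K n (kval c) (gd c)) ->
     \sum_(c : n.-tuple 'I_n.+1 | kupisch c) 'X^(gd c)
     = \sum_(D : (2 * n.-1).-tuple bool | dyck D) 'X^(height D) :> {poly int}).
Proof.
case: n hn => // m _; split=> [c Hc | gd Hgd].
  by exists (height_from 0 (theta_dyck m (dyck_of (klist c)))); apply: is_gldim_theta.
rewrite succnK.
pose F s : {poly int} := 'X^(height_from 0 s).
transitivity (\sum_(s <- dycks m) F s); last first.
  rewrite big_map big_enum /=; apply: eq_bigr => D HD.
  by rewrite /F heightE.
(* The sum over Dyck words is reindexed first by [theta_dyck], then by Kupisch series. *)
rewrite -(perm_big _ (perm_theta_dyck m)) big_map -(perm_big _ (perm_kupisch_dycks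
  m)) big_map big_enum.
by apply: eq_bigr => c Hc; congr 'X^_;
  apply: is_gldim_uniq (Hgd c Hc) (is_gldim_theta _ Hc).
Qed.
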